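(* There is an absolute constant $C>0$ such that the following holds. Let $r>0$ and let $S$ be a set of $n\ge 1$ points (sites) in $\mathbb{H}^2$ with pairwise hyperbolic distance at least $2r$. Then the Delaunay complex $\mathcal{D}(S)$ is $k$-outerplanar for some $k\le 1+C\,\frac{\log n}{r}$.
   Context: $\mathbb{H}^2$ is the hyperbolic plane of curvature $-1$ with distance $d$, viewed in the Poincaré disk model. For a finite set $S\subset\mathbb{H}^2$, the Voronoi cell of $s\in S$ is the set of points of $\mathbb{H}^2$ closer to $s$ than to any other site; Voronoi edges are the maximal non-degenerate segments of bisectors lying on the common boundary of two cells. The Delaunay complex $\mathcal{D}(S)$ is the plane graph with vertex set $S$ in which $s_1,s_2$ are adjacent iff their Voronoi cells share a Voronoi edge; each such edge is drawn as the two hyperbolic segments from $s_1$ and $s_2$ to a common point in the relative interior of the shared Voronoi edge (this drawing is planar). Its bounded (inner) faces correspond to Voronoi vertices, and it has one unbounded (outer) face; a site lies on the outer face iff its Voronoi cell is unbounded. A plane graph is $1$-outerplanar if all its vertices lie on the outer face, and $k$-outerplanar if deleting all vertices on the outer face (with their incident edges) yields a $(k-1)$-outerplanar graph. *)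

(* Defs.v *)
From Stdlib Require Import Reals List.
Open Scope R_scope.

Definition pt := (R * R)%type.
Definition norm2 (p : pt) : R := fst p * fst p + snd p * snd p.
Definition dist2 (p q : pt) : R :=
  (fst p - fst q) * (fst p - fst q) + (snd p - snd q) * (snd p - snd q).
Definition in_disk (p : pt) : Prop := norm2 p < 1.

Definition acosh (x : R) : R := ln (x + sqrt (x * x - 1)).

(* Hyperbolic distance (curvature -1) in the Poincare disk. *)
Definition hdist (p q : pt) : R :=
  acosh (1 + 2 * dist2 p q / ((1 - norm2 p) * (1 - norm2 q))).

Definition hseg (a b p : pt) : Prop :=
  in_disk p /\ hdist a p + hdist p b = hdist a b.

(* Common boundary of the Voronoi cells of s and t (a possibly degenerate
   segment of the bisector of s,t). *)
Definition voronoi_common_bd (S : list pt) (s t p : pt) : Prop :=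
  in_disk p /\ hdist p s = hdist p t /\
  (forall u, In u S -> hdist p s <= hdist p u).

(* s,t adjacent in the Delaunay complex: the common boundary contains a
   non-degenerate segment (i.e. at least two points). *)
Definition delaunay_adj (S : list pt) (s t : pt) : Prop :=
  In s S /\ In t S /\ s <> t /\
  exists p q, p <> q /\ voronoi_common_bd S s t p /\ voronoi_common_bd S s t q.

Definition vedge_relint (S : list pt) (s t p : pt) : Prop :=
  in_disk p /\ hdist p s = hdist p t /\
  (forall u, In u S -> u <> s -> u <> t -> hdist p s < hdist p u).

Definition valid_midpoints (S : list pt) (m : pt -> pt -> pt) : Prop :=
  forall s t, delaunay_adj S s t -> m s t = m t s /\ vedge_relint S s t (m s t).

Definition drawing (S : list pt) (m : pt -> pt -> pt) (V : pt -> Prop) (p : pt)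
  : Prop :=
  V p \/ exists s t, V s /\ V t /\ delaunay_adj S s t /\
                     (hseg s (m s t) p \/ hseg (m s t) t p).

(* v lies on the outer (unbounded) face of that drawing: v can be joined to
   infinity (the boundary circle of the disk) by a path avoiding the drawing
   except at its start. *)
Definition on_outer_face (S : list pt) (m : pt -> pt -> pt) (V : pt -> Prop)
  (v : pt) : Prop :=
  exists g : R -> pt,
    g 0 = v /\
    (forall t, 0 <= t < 1 -> forall eps, eps > 0 -> exists delta, delta > 0 /\
       forall t', 0 <= t' < 1 -> Rabs (t' - t) < delta ->
         dist2 (g t') (g t) < eps * eps) /\
    (forall t, 0 < t < 1 -> in_disk (g t) /\ ~ drawing S m V (g t)) /\
    (forall eps, eps > 0 -> exists t0, t0 < 1 /\
       forall t, t0 < t < 1 -> norm2 (g t) > 1 - eps).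

Definition peel (S : list pt) (m : pt -> pt -> pt) (V : pt -> Prop) : pt -> Prop :=
  fun v => V v /\ ~ on_outer_face S m V v.

Fixpoint k_outerplanar (S : list pt) (m : pt -> pt -> pt) (k : nat)
  (V : pt -> Prop) : Prop :=
  match k with
  | O => forall v, ~ V v
  | Datatypes.S k' => k_outerplanar S m k' (peel S m V)
  end.

(* Main.v *)
(* Lift the disk to the hyperboloid, where cosh of the distance is the Minkowski
   product [mink]. Nearest-site regions become convex cones, and hyperbolic
   segments lie in the cones spanned by their ends.

   Outer layers. The drawing of the remaining sites stays inside their cells, so
   the cell of a removed site is free. If the cells of [v] and of a removed site
   [t] share a point, [v] escapes through that point and [t] and is removed in the
   next round. Hence the number of rounds is at most the number of cells in a
   chain of touching cells from any site to infinity.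

   Short chains. Follow a ray from a site [v] until it reaches infinity or first
   meets a cell whose site [u] is far from [v]. Being no farther than [v] from a
   point of the ray, [u] lies almost in the direction of the ray, and so does the
   half-plane at [u] perpendicular to [vu]. Thus M separated directions give
   disjoint half-planes, and if all these rays fail to lead quickly to infinity,
   iterating j times produces M^j sites; so j <= log n / log M. For large r every
   site is far and M is exponential in r. For small r, M = 2 and O(1/r) cells are
   crossed between jumps, which is proved with the function [potential]. *)
Require Import Defs.
From Stdlib Require Import Reals List ZArith Lra Lia Classical Nsatz.
Open Scope R_scope.

(** * The hyperboloid *)

Record vec := Vec { vt : R; vx : R; vy : R }.
Definition mink (a b : vec) : R := vt a * vt b - vx a * vx b - vy a * vy b.
Definition lin (a : R) (A : vec) (b : R) (B : vec) : vec :=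
  Vec (a * vt A + b * vt B) (a * vx A + b * vx B) (a * vy A + b * vy B).
Definition lift (p : pt) : vec :=
  Vec ((1 + norm2 p) / (1 - norm2 p)) (2 * fst p / (1 - norm2 p))
      (2 * snd p / (1 - norm2 p)).
(** Stereographic projection of the normalized vector, with the normalization cleared so that null
    vectors are allowed; those go to the unit circle. *)
Definition proj (Q : vec) : pt :=
  (vx Q / (vt Q + sqrt (mink Q Q)), vy Q / (vt Q + sqrt (mink Q Q))).

Lemma mink_comm A B : mink A B = mink B A.
Proof. unfold mink; ring. Qed.

Lemma mink_lin_l a A b B W : mink (lin a A b B) W = a * mink A W + b * mink B W.
Proof. unfold mink, lin; simpl; ring. Qed.

Lemma mink_lin_r a A b B W : mink W (lin a A b B) = a * mink W A + b * mink W B.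
Proof. unfold mink, lin; simpl; ring. Qed.

Lemma norm2_ge0 p : 0 <= norm2 p.
Proof.
  unfold norm2; pose proof (Rle_0_sqr (fst p)); pose proof (Rle_0_sqr (snd p));
    unfold Rsqr in *; lra.
Qed.

Lemma dist2_ge0 p q : 0 <= dist2 p q.
Proof.
  unfold dist2; pose proof (Rle_0_sqr (fst p - fst q));
    pose proof (Rle_0_sqr (snd p - snd q)); unfold Rsqr in *; lra.
Qed.

Lemma dist2_eq0 p q : dist2 p q = 0 -> p = q.
Proof.
  destruct p as [a b], q as [c d]; unfold dist2; simpl; intro H.
  destruct (Rplus_sqr_eq_0 (a - c) (b - d) H).
  f_equal; lra.
Qed.

Lemma mink_lift p q : in_disk p -> in_disk q ->
  mink (lift p) (lift q) =
  1 + 2 * dist2 p q / ((1 - norm2 p) * (1 - norm2 q)).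
Proof.
  unfold in_disk, mink, lift; simpl; intros.
  unfold dist2, norm2 in *; field; lra.
Qed.

Lemma mink_lift_self p : in_disk p -> mink (lift p) (lift p) = 1.
Proof.
  unfold in_disk, mink, lift; simpl; intros.
  unfold norm2 in *; field; lra.
Qed.

Lemma lift_future p : in_disk p -> 1 <= vt (lift p).
Proof.
  unfold in_disk, lift; simpl; intros; pose proof (norm2_ge0 p).
  apply Rmult_le_reg_r with (1 - norm2 p); [lra|].
  field_simplify; lra.
Qed.

Lemma mink_lift_ge1 p q : in_disk p -> in_disk q -> 1 <= mink (lift p) (lift q).
Proof.
  intros Hp Hq; rewrite mink_lift by easy; unfold in_disk in *.
  pose proof (dist2_ge0 p q).
  assert (0 <= 2 * dist2 p q / ((1 - norm2 p) * (1 - norm2 q))); [|lra].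
  apply Rle_mult_inv_pos; [lra|]. apply Rmult_lt_0_compat; lra.
Qed.

Lemma mink_lift_gt1 p q : in_disk p -> in_disk q -> p <> q ->
  1 < mink (lift p) (lift q).
Proof.
  intros Hp Hq Hne. destruct (mink_lift_ge1 p q Hp Hq) as [H|H]; [easy|].
  exfalso; apply Hne, dist2_eq0. rewrite mink_lift in H by easy.
  unfold in_disk in *.
  assert (E : 2 * dist2 p q / ((1 - norm2 p) * (1 - norm2 q)) = 0) by lra.
  assert (P : 0 < (1 - norm2 p) * (1 - norm2 q)) by (apply Rmult_lt_0_compat; lra).
  apply (f_equal (fun z => z * ((1 - norm2 p) * (1 - norm2 q)))) in E.
  field_simplify in E; lra.
Qed.

(** * Distances and segments in terms of the Minkowski product *)

Lemma exp_acosh x : 1 <= x -> exp (acosh x) = x + sqrt (x * x - 1).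
Proof.
  intro; unfold acosh; apply exp_ln. pose proof (sqrt_pos (x * x - 1)); lra.
Qed.

Lemma acosh_incr x y : 1 <= x -> x < y -> acosh x < acosh y.
Proof.
  intros; unfold acosh; apply ln_increasing.
  - pose proof (sqrt_pos (x * x - 1)); lra.
  - assert (sqrt (x * x - 1) <= sqrt (y * y - 1)) by (apply sqrt_le_1_alt; nra). lra.
Qed.

Lemma hdist_mink p q : in_disk p -> in_disk q ->
  hdist p q = acosh (mink (lift p) (lift q)).
Proof. intros; unfold hdist; rewrite mink_lift by easy; reflexivity. Qed.

Lemma hdist_le_mink p s u : in_disk p -> in_disk s -> in_disk u ->
  hdist p s <= hdist p u -> mink (lift p) (lift s) <= mink (lift p) (lift u).
Proof.
  intros Hp Hs Hu; rewrite !hdist_mink by easy; intro H.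
  apply Rnot_lt_le; intro L.
  apply (acosh_incr _ _ (mink_lift_ge1 _ _ Hp Hu)) in L; lra.
Qed.

Lemma hdist_lt_mink p s u : in_disk p -> in_disk s -> in_disk u ->
  hdist p s < hdist p u -> mink (lift p) (lift s) < mink (lift p) (lift u).
Proof.
  intros Hp Hs Hu; rewrite !hdist_mink by easy; intro H.
  apply Rnot_le_lt; intros [L|L].
  - apply (acosh_incr _ _ (mink_lift_ge1 _ _ Hp Hu)) in L; lra.
  - rewrite L in H; lra.
Qed.

(** The addition formula for cosh. As [x - sqrt (x * x - 1)] is the reciprocal of
    [x + sqrt (x * x - 1)], the product formula for the exponentials passes to the conjugates;
    averaging both gives the claim. *)
Lemma acosh_add x y z : 1 <= x -> 1 <= y -> 1 <= z ->
  acosh x + acosh y = acosh z ->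
  z = x * y + sqrt (x * x - 1) * sqrt (y * y - 1).
Proof.
  intros Hx Hy Hz H.
  apply (f_equal exp) in H. rewrite exp_plus, !exp_acosh in H by easy.
  pose proof (sqrt_sqrt (x * x - 1) ltac:(nra)) as Sx.
  pose proof (sqrt_sqrt (y * y - 1) ltac:(nra)) as Sy.
  pose proof (sqrt_sqrt (z * z - 1) ltac:(nra)) as Sz.
  pose proof (sqrt_pos (x * x - 1)). pose proof (sqrt_pos (y * y - 1)).
  pose proof (sqrt_pos (z * z - 1)).
  set (a := sqrt (x * x - 1)) in *. set (b := sqrt (y * y - 1)) in *.
  set (c := sqrt (z * z - 1)) in *.
  assert (I : (x - a) * (y - b) = z - c).
  { apply Rmult_eq_reg_l with (z + c); [|lra].
    rewrite <- H at 1.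
    replace ((x + a) * (y + b) * ((x - a) * (y - b)))
      with ((x * x - a * a) * (y * y - b * b)) by ring.
    rewrite Sx, Sy. replace ((z + c) * (z - c)) with (z * z - c * c) by ring.
    rewrite Sz; ring. }
  lra.
Qed.

(* The form is negative definite on the orthogonal complement of a timelike vector. *)
Lemma null_orthogonal_zero Z P : mink P P = 1 -> mink Z P = 0 -> mink Z Z = 0 ->
  vt Z = 0 /\ vx Z = 0 /\ vy Z = 0.
Proof.
  destruct Z as [a b c], P as [p q s]; unfold mink; simpl; intros H1 H2 H3.
  assert (L : (a * p) * (a * p) <= (b * b + c * c) * (q * q + s * s)).
  { replace (a * p) with (b * q + c * s) by lra.
    pose proof (Rle_0_sqr (b * s - c * q)); unfold Rsqr in *; nra. }
  assert (E : a * a = b * b + c * c) by lra.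
  assert (b * b + c * c <= 0) by nra.
  assert (b = 0) by nra. assert (c = 0) by nra. assert (a = 0) by nra. easy.
Qed.

Lemma vec_eq A B : vt A = vt B -> vx A = vx B -> vy A = vy B -> A = B.
Proof. destruct A, B; simpl; intros; subst; easy. Qed.

Lemma lift_inj_mink p q : in_disk p -> in_disk q ->
  mink (lift p) (lift q) <= 1 -> p = q.
Proof.
  intros Hp Hq H. apply NNPP; intro N.
  pose proof (mink_lift_gt1 p q Hp Hq N); lra.
Qed.

(** Let [sg], [rh], [c] be sinh of d(a,p), d(p,b), d(a,b). The vector [c P - rh A - sg B] is
    orthogonal to [P] and, by the addition formula, null; hence it vanishes. *)
Lemma hseg_lift a b p : in_disk a -> in_disk b -> hseg a b p ->
  in_disk p /\ exists al be, 0 <= al /\ 0 <= be /\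
    lift p = lin al (lift a) be (lift b).
Proof.
  intros Ha Hb [Hp H]; split; [easy|].
  rewrite !hdist_mink in H by easy.
  apply acosh_add in H; try (apply mink_lift_ge1; easy).
  pose proof (mink_lift_ge1 a p Ha Hp) as X1.
  pose proof (mink_lift_ge1 p b Hp Hb) as Y1.
  pose proof (mink_lift_self a Ha) as Aa. pose proof (mink_lift_self b Hb) as Bb.
  pose proof (mink_lift_self p Hp) as Pp.
  pose proof (lift_inj_mink a p Ha Hp) as Eap.
  set (A := lift a) in *; set (B := lift b) in *; set (P := lift p) in *.
  set (x := mink A P) in *; set (y := mink P B) in *.
  pose proof (sqrt_sqrt (x * x - 1) ltac:(nra)) as Sx.
  pose proof (sqrt_sqrt (y * y - 1) ltac:(nra)) as Sy.
  pose proof (sqrt_pos (x * x - 1)) as S0. pose proof (sqrt_pos (y * y - 1)) as R0.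
  set (sg := sqrt (x * x - 1)) in *. set (rh := sqrt (y * y - 1)) in *.
  (* If all three points coincide, [c] is 0; hence [p = a] is treated apart. *)
  destruct (Rle_lt_dec x 1) as [Hx|Hx].
  { exists 1, 0. assert (a = p) by (apply Eap; lra). subst p.
    split; [lra|]. split; [lra|]. subst A P.
    apply vec_eq; unfold lin; simpl; ring. }
  assert (Spos : 0 < sg) by nra.
  set (c := sg * y + rh * x).
  assert (Cpos : 0 < c) by (unfold c; nra).
  destruct (null_orthogonal_zero (lin c P 1 (lin (- rh) A (- sg) B)) P Pp) as [Z0 [Z1 Z2]].
  - rewrite !mink_lin_l. fold x. rewrite Pp, (mink_comm B P). fold y.
    unfold c; ring.
  - rewrite !mink_lin_l, !mink_lin_r.
    rewrite Pp, Aa, Bb, (mink_comm P A), (mink_comm B P), (mink_comm B A), H.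
    fold x; fold y. unfold c.
    replace (x * x) with (sg * sg + 1) by lra.
    transitivity (sg * sg + rh * rh - sg * sg * (y * y) - rh * rh * (x * x)
      + 2 * (sg * sg) * (rh * rh)); [ring|].
    replace (x * x) with (sg * sg + 1) by lra.
    replace (y * y) with (rh * rh + 1) by lra. ring.
  - exists (rh / c), (sg / c).
    split; [apply Rle_mult_inv_pos; lra|]. split; [apply Rle_mult_inv_pos; lra|].
    unfold lin in *; simpl in *.
    assert (D : forall z u v, c * z + 1 * (- rh * u + - sg * v) = 0 ->
      z = rh / c * u + sg / c * v).
    { intros z u v E. apply Rmult_eq_reg_l with c; [|lra].
      replace (c * (rh / c * u + sg / c * v)) with (rh * u + sg * v)
        by (field; lra). lra. }
    apply vec_eq; simpl; apply D; easy.
Qed.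

(** * Paths *)

(** Reversed Cauchy-Schwarz inequality; [B] may be null, which covers ideal points. *)
Lemma mink_pos A B : 0 < vt A -> 0 < vt B -> 0 < mink A A -> 0 <= mink B B ->
  0 < mink A B.
Proof.
  destruct A as [a b c], B as [p q s]; unfold mink; simpl; intros Ha Hp HA HB.
  assert (L : (b * q + c * s) * (b * q + c * s) <=
              (b * b + c * c) * (q * q + s * s)).
  { pose proof (Rle_0_sqr (b * s - c * q)); unfold Rsqr in *; lra. }
  assert (M : (b * b + c * c) * (q * q + s * s) < (a * p) * (a * p)).
  { apply Rle_lt_trans with ((b * b + c * c) * (p * p)).
    - apply Rmult_le_compat_l; [|lra].
      pose proof (Rle_0_sqr b); pose proof (Rle_0_sqr c); unfold Rsqr in *; lra.
    - assert (0 < p * p) by nra. nra. }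
  assert (0 < a * p) by nra.
  assert (b * q + c * s < a * p) by (apply Rnot_le_lt; intro; nra). lra.
Qed.

(** A straight chord projects to a hyperbolic segment, and its far end may be ideal. *)
Definition seg (A B : vec) (t : R) : vec := lin (1 - t) A t B.

Lemma seg_mink A B t : mink (seg A B t) (seg A B t) =
  (1 - t) * (1 - t) * mink A A + 2 * t * (1 - t) * mink A B + t * t * mink B B.
Proof. unfold seg, mink, lin; simpl; ring. Qed.

Lemma seg_future A B t : 0 < vt A -> 0 < vt B -> 0 <= t <= 1 -> 0 < vt (seg A B t).
Proof. unfold seg; simpl; intros. destruct (Rle_lt_dec t (1/2)); nra. Qed.

Lemma seg_timelike A B t : 0 < vt A -> 0 < vt B -> 0 < mink A A ->
  0 <= mink B B -> 0 <= t < 1 -> 0 < mink (seg A B t) (seg A B t).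
Proof.
  intros H1 H2 H3 H4 Ht; rewrite seg_mink.
  pose proof (mink_pos A B H1 H2 H3 H4).
  assert (0 < (1 - t) * (1 - t) * mink A A) by (apply Rmult_lt_0_compat; nra).
  assert (0 <= t * t * mink B B) by (apply Rmult_le_pos; nra).
  assert (0 <= 2 * t * (1 - t) * mink A B) by (apply Rmult_le_pos; nra). lra.
Qed.

Lemma norm2_proj Q : 0 < vt Q -> 0 <= mink Q Q ->
  1 - norm2 (proj Q) = 2 * sqrt (mink Q Q) / (vt Q + sqrt (mink Q Q)).
Proof.
  intros HQ Hq. pose proof (sqrt_pos (mink Q Q)).
  pose proof (sqrt_sqrt _ Hq) as E. unfold norm2, proj; simpl.
  set (q := sqrt (mink Q Q)) in *.
  replace (vx Q / (vt Q + q) * (vx Q / (vt Q + q)) + vy Q / (vt Q + q) * (vy Q / (vt Q + q)))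
    with ((vx Q * vx Q + vy Q * vy Q) / ((vt Q + q) * (vt Q + q))) by (field; lra).
  replace (vx Q * vx Q + vy Q * vy Q) with (vt Q * vt Q - q * q)
    by (rewrite E; unfold mink; ring).
  field; lra.
Qed.

Lemma proj_in_disk Q : 0 < vt Q -> 0 < mink Q Q -> in_disk (proj Q).
Proof.
  intros HQ Hq. pose proof (sqrt_lt_R0 _ Hq).
  pose proof (norm2_proj Q HQ (Rlt_le _ _ Hq)) as E. unfold in_disk.
  assert (0 < 2 * sqrt (mink Q Q) / (vt Q + sqrt (mink Q Q))); [|lra].
  apply Rdiv_lt_0_compat; lra.
Qed.

Lemma lift_proj Q : 0 < vt Q -> 0 < mink Q Q ->
  exists k, 0 < k /\ lift (proj Q) = lin k Q 0 Q.
Proof.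
  intros HQ Hq. pose proof (sqrt_lt_R0 _ Hq).
  pose proof (norm2_proj Q HQ (Rlt_le _ _ Hq)) as E.
  exists (/ sqrt (mink Q Q)). split; [apply Rinv_0_lt_compat; easy|].
  apply vec_eq; unfold lift; simpl; rewrite E;
    try replace (1 + norm2 (proj Q)) with (2 - (1 - norm2 (proj Q))) by ring;
    rewrite ?E; field; lra.
Qed.

Lemma proj_lift p : in_disk p -> proj (lift p) = p.
Proof.
  intro Hp; unfold proj. rewrite mink_lift_self, sqrt_1 by easy.
  unfold in_disk in Hp. destruct p as [a b]; unfold lift; simpl.
  f_equal; field; lra.
Qed.

Lemma continuity_pt_eps f x : continuity_pt f x -> forall eps, 0 < eps ->
  exists d, 0 < d /\ forall y, Rabs (y - x) < d -> Rabs (f y - f x) < eps.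
Proof.
  intros H eps He. destruct (H eps He) as [d [Hd K]]. exists d; split; [easy|].
  intros y Hy. destruct (Req_dec x y) as [->|N].
  - rewrite Rminus_diag, Rabs_R0; easy.
  - apply K; split; [split; easy|easy].
Qed.

Lemma continuity_pt_comp_seg (f : vec -> R) A B t :
  (f = vt \/ f = vx \/ f = vy) -> continuity_pt (fun u => f (seg A B u)) t.
Proof. intros [->|[->| ->]]; unfold seg; simpl; reg. Qed.

Lemma seg_proj_continuity A B t : 0 < vt (seg A B t) ->
  0 <= mink (seg A B t) (seg A B t) ->
  continuity_pt (fun u => fst (proj (seg A B u))) t /\
  continuity_pt (fun u => snd (proj (seg A B u))) t.
Proof.
  intros H1 H2.
  assert (D : continuity_pt
    (fun u => vt (seg A B u) + sqrt (mink (seg A B u) (seg A B u))) t).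
  { apply (continuity_pt_plus (fun u => vt (seg A B u))
      (fun u => sqrt (mink (seg A B u) (seg A B u)))).
    - apply continuity_pt_comp_seg; auto.
    - apply (continuity_pt_comp (fun u => mink (seg A B u) (seg A B u)) sqrt).
      + unfold mink, seg; simpl; reg.
      + apply continuity_pt_sqrt; easy. }
  assert (N : vt (seg A B t) + sqrt (mink (seg A B t) (seg A B t)) <> 0).
  { pose proof (sqrt_pos (mink (seg A B t) (seg A B t))). lra. }
  split; unfold proj; simpl.
  - apply (continuity_pt_div (fun u => vx (seg A B u))); [|easy|exact N].
    apply continuity_pt_comp_seg; auto.
  - apply (continuity_pt_div (fun u => vy (seg A B u))); [|easy|exact N].
    apply continuity_pt_comp_seg; auto.
Qed.

Lemma seg_proj_eps A B t : 0 < vt (seg A B t) ->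
  0 <= mink (seg A B t) (seg A B t) -> forall eps, eps > 0 ->
  exists d, d > 0 /\ forall u, Rabs (u - t) < d ->
    dist2 (proj (seg A B u)) (proj (seg A B t)) < eps * eps.
Proof.
  intros H1 H2 eps He. destruct (seg_proj_continuity A B t H1 H2) as [C1 C2].
  destruct (continuity_pt_eps _ _ C1 (eps / 2) ltac:(lra)) as [d1 [D1 K1]].
  destruct (continuity_pt_eps _ _ C2 (eps / 2) ltac:(lra)) as [d2 [D2 K2]].
  exists (Rmin d1 d2). split; [apply Rmin_pos; lra|]. intros u Hu.
  pose proof (Rmin_l d1 d2). pose proof (Rmin_r d1 d2).
  specialize (K1 u ltac:(lra)). specialize (K2 u ltac:(lra)).
  apply Rabs_def2 in K1. apply Rabs_def2 in K2. unfold dist2. nra.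
Qed.

Lemma seg_proj_to_circle A B : 0 < vt B -> mink B B = 0 ->
  forall eps, eps > 0 -> exists t0, t0 < 1 /\
    forall t, t0 < t < 1 -> norm2 (proj (seg A B t)) > 1 - eps.
Proof.
  intros HB Hn eps He.
  assert (E : seg A B 1 = B) by (apply vec_eq; unfold seg; simpl; ring).
  destruct (seg_proj_continuity A B 1) as [C1 C2]; rewrite ?E; try lra.
  assert (C : continuity_pt (fun u => norm2 (proj (seg A B u))) 1).
  { unfold norm2.
    apply (continuity_pt_plus
      (fun u => fst (proj (seg A B u)) * fst (proj (seg A B u)))
      (fun u => snd (proj (seg A B u)) * snd (proj (seg A B u)))).
    - apply (continuity_pt_mult (fun u => fst (proj (seg A B u)))
        (fun u => fst (proj (seg A B u)))); easy.
    - apply (continuity_pt_mult (fun u => snd (proj (seg A B u)))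
        (fun u => snd (proj (seg A B u)))); easy. }
  destruct (continuity_pt_eps _ _ C eps He) as [d [Hd K]].
  exists (1 - d). split; [lra|]. intros t Ht.
  specialize (K t). rewrite E in K.
  pose proof (norm2_proj B HB ltac:(lra)) as N. rewrite Hn, sqrt_0 in N.
  replace (2 * 0 / (vt B + 0)) with 0 in N by (field; lra).
  assert (Rabs (t - 1) < d) by (apply Rabs_def1; lra).
  apply K, Rabs_def2 in H. lra.
Qed.

(** The path is [h] followed by [g], each at double speed. The junction becomes an interior point,
    where [g] guarantees nothing, so [h] has to be free at 1 too. *)
Lemma outer_prepend S m V (h : R -> pt) :
  (forall t, 0 <= t <= 1 -> forall eps, eps > 0 -> exists d, d > 0 /\
     forall u, Rabs (u - t) < d -> dist2 (h u) (h t) < eps * eps) ->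
  (forall t, 0 < t <= 1 -> in_disk (h t) /\ ~ drawing S m V (h t)) ->
  on_outer_face S m V (h 1) -> on_outer_face S m V (h 0).
Proof.
  intros Hc Hd [g [G0 [Gc [Gd Gi]]]].
  exists (fun t => if Rle_dec t (1/2) then h (2 * t) else g (2 * t - 1)).
  split; [|split; [|split]].
  - destruct (Rle_dec 0 (1/2)); [f_equal; ring|lra].
  - intros t Ht eps He. destruct (Rtotal_order t (1/2)) as [L|[L|L]].
    + destruct (Hc (2 * t) ltac:(lra) eps He) as [d [Dp K]].
      exists (Rmin (d / 2) (1 / 2 - t)). split; [apply Rmin_pos; lra|].
      intros u Hu Hut. pose proof (Rmin_l (d / 2) (1 / 2 - t)).
      pose proof (Rmin_r (d / 2) (1 / 2 - t)). apply Rabs_def2 in Hut.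
      destruct (Rle_dec u (1/2)); [|lra]. destruct (Rle_dec t (1/2)); [|lra].
      apply K. apply Rabs_def1; lra.
    + destruct (Hc 1 ltac:(lra) eps He) as [d [Dp K]].
      destruct (Gc 0 ltac:(lra) eps He) as [d' [Dp' K']].
      exists (Rmin (d / 2) (d' / 2)). split; [apply Rmin_pos; lra|].
      intros u Hu Hut. pose proof (Rmin_l (d / 2) (d' / 2)).
      pose proof (Rmin_r (d / 2) (d' / 2)). apply Rabs_def2 in Hut.
      destruct (Rle_dec t (1/2)); [|lra]. replace (2 * t) with 1 by lra.
      destruct (Rle_dec u (1/2)).
      * apply K, Rabs_def1; lra.
      * rewrite <- G0. apply K'; [lra|]. apply Rabs_def1; lra.
    + destruct (Gc (2 * t - 1) ltac:(lra) eps He) as [d [Dp K]].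
      exists (Rmin (d / 2) (t - 1 / 2)). split; [apply Rmin_pos; lra|].
      intros u Hu Hut. pose proof (Rmin_l (d / 2) (t - 1 / 2)).
      pose proof (Rmin_r (d / 2) (t - 1 / 2)). apply Rabs_def2 in Hut.
      destruct (Rle_dec u (1/2)); [lra|]. destruct (Rle_dec t (1/2)); [lra|].
      apply K; [lra|]. apply Rabs_def1; lra.
  - intros t Ht. destruct (Rle_dec t (1/2)).
    + apply Hd; lra.
    + apply Gd; lra.
  - intros eps He. destruct (Gi eps He) as [t0 [T0 K]].
    exists (Rmax (1/2) ((t0 + 1) / 2)). split; [apply Rmax_lub_lt; lra|].
    intros t Ht. pose proof (Rmax_l (1/2) ((t0 + 1) / 2)).
    pose proof (Rmax_r (1/2) ((t0 + 1) / 2)).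
    destruct (Rle_dec t (1/2)); [lra|]. apply K; lra.
Qed.

(** * Chains of touching cells *)

Definition nearest (S : list pt) (Q : vec) (w : pt) : Prop :=
  forall u, In u S -> mink Q (lift w) <= mink Q (lift u).

(* [esc S i v]: the cell of [v] is joined to infinity by a chain of at most [i]
   cells, consecutive ones having a common point; null vectors [Q] are the
   points at infinity. *)
Inductive esc (S : list pt) : nat -> pt -> Prop :=
| esc_ideal i v Q : In v S -> 0 < vt Q -> mink Q Q = 0 -> nearest S Q v ->
    esc S (Datatypes.S i) v
| esc_touch i v u Q : In v S -> In u S -> 0 < vt Q -> 0 < mink Q Q ->
    nearest S Q v -> nearest S Q u -> esc S i u -> esc S (Datatypes.S i) v.

Lemma esc_mono S i j v : (i <= j)%nat -> esc S i v -> esc S j v.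
Proof.
  intros L H; revert j L; induction H; intros [|j] L; try lia.
  - apply esc_ideal with Q; easy.
  - apply esc_touch with u Q; try easy. apply IHesc; lia.
Qed.

(** Both halves of an edge take one form, with [a] the site where the half starts; linear
    inequalities then apply to the points of the drawing. *)
Lemma drawing_segment S m V p : (forall s, In s S -> in_disk s) ->
  valid_midpoints S m -> drawing S m V p ->
  V p \/ exists a b M al be, V a /\ V b /\ In a S /\ In b S /\ a <> b /\
    in_disk p /\ in_disk M /\ 0 <= al /\ 0 <= be /\
    lift p = lin al (lift a) be (lift M) /\
    mink (lift M) (lift a) = mink (lift M) (lift b) /\
    (forall u, In u S -> u <> a -> u <> b ->
       mink (lift M) (lift a) < mink (lift M) (lift u)).
Proof.
  intros HS Hm [H|[s [t [Vs [Vt [Hadj H]]]]]]; [now left|right].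
  pose proof Hadj as [Is [It [Nst _]]].
  destruct (Hm s t Hadj) as [_ [MD [E1 E2]]].
  assert (E : mink (lift (m s t)) (lift s) = mink (lift (m s t)) (lift t)).
  { apply Rle_antisym; apply hdist_le_mink; auto; lra. }
  assert (E' : forall u, In u S -> u <> s -> u <> t ->
    mink (lift (m s t)) (lift s) < mink (lift (m s t)) (lift u)).
  { intros; apply hdist_lt_mink; auto. }
  destruct H as [H|H]; apply hseg_lift in H as [Hp [al [be [Ha [Hb L]]]]]; auto.
  - exists s, t, (m s t), al, be. repeat (split; [easy|]). easy.
  - exists t, s, (m s t), be, al.
    repeat match goal with |- _ /\ _ => split end; auto.
    + rewrite L; apply vec_eq; unfold lin; simpl; ring.
    + intros. rewrite <- E. auto.
Qed.

(** Both ends [a] and [M] of a half-edge are strictly closer to [a] than to [t], hence so is every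
    point between them. *)
Lemma removed_cell_free S m (V : pt -> Prop) t p :
  (forall s, In s S -> in_disk s) -> valid_midpoints S m ->
  (forall s, V s -> In s S) -> In t S -> ~ V t -> in_disk p ->
  nearest S (lift p) t -> ~ drawing S m V p.
Proof.
  intros HS Hm HV It Nt Hp Hn D.
  destruct (drawing_segment S m V p HS Hm D)
    as [Vp|[a [b [M [al [be [Va [Vb [Ia [Ib [Nab [_ [HM [Ha [Hb [L [E1 E2]]]]]]]]]]]]]]]]].
  - specialize (Hn p (HV p Vp)). rewrite mink_lift_self in Hn by easy.
    apply lift_inj_mink in Hn; auto. subst; easy.
  - specialize (Hn a Ia). rewrite L, !mink_lin_l in Hn.
    assert (t <> a) by (intros ->; easy). assert (t <> b) by (intros ->; easy).
    pose proof (mink_lift_gt1 a t (HS a Ia) (HS t It) ltac:(auto)).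
    rewrite (mink_lift_self a) in Hn by auto.
    specialize (E2 t It ltac:(auto) ltac:(auto)).
    (* A positive time coordinate excludes [al = be = 0]. *)
    pose proof (lift_future p Hp) as F. rewrite L in F; unfold lin in F; simpl vt in F.
    assert (al = 0) by nra. assert (be = 0) by nra. subst. lra.
Qed.

Lemma seg_nearest S A B t v : 0 <= t <= 1 -> nearest S A v -> nearest S B v ->
  nearest S (seg A B t) v.
Proof.
  intros Ht HA HB u Hu. unfold seg. rewrite !mink_lin_l.
  specialize (HA u Hu); specialize (HB u Hu). nra.
Qed.

Lemma site_nearest S v : (forall s, In s S -> in_disk s) -> In v S ->
  nearest S (lift v) v.
Proof.
  intros HS Iv u Iu. rewrite mink_lift_self by auto.
  apply mink_lift_ge1; auto.
Qed.

Lemma nearest_proj S Q v : 0 < vt Q -> 0 < mink Q Q -> nearest S Q v ->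
  nearest S (lift (proj Q)) v.
Proof.
  intros H1 H2 Hn u Iu. destruct (lift_proj Q H1 H2) as [k [Hk ->]].
  rewrite !mink_lin_l. specialize (Hn u Iu). nra.
Qed.

(* If the open segment from [v] to [Q] met an edge, that edge would have to start
   at [v] with its midpoint [M] beyond [Q], because beyond [M] the other end of
   the edge is closer than [v]. Then [Q] would be an interior point of the disk
   whose only nearest sites are the two ends of the edge. *)
Lemma cell_segment_free S m (V : pt -> Prop) v Q t :
  (forall s, In s S -> in_disk s) -> valid_midpoints S m ->
  (forall s, V s -> In s S) -> V v -> 0 < vt Q -> 0 <= mink Q Q ->
  nearest S Q v ->
  (mink Q Q = 0 \/ exists u, In u S /\ ~ V u /\ nearest S Q u) ->
  0 < t < 1 -> ~ drawing S m V (proj (seg (lift v) Q t)).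
Proof.
  intros HS Hm HV Vv FQ TQ Hn HQ Ht D.
  pose proof (HV v Vv) as Iv. pose proof (HS v Iv) as Dv.
  pose proof (lift_future v Dv) as Fv. pose proof (mink_lift_self v Dv) as Nv.
  assert (F : 0 < vt (seg (lift v) Q t)) by (apply seg_future; lra).
  assert (T : 0 < mink (seg (lift v) Q t) (seg (lift v) Q t))
    by (apply seg_timelike; lra).
  assert (St : forall u, In u S -> u <> v ->
    mink (seg (lift v) Q t) (lift v) < mink (seg (lift v) Q t) (lift u)).
  { intros u Iu Nu. unfold seg; rewrite !mink_lin_l, Nv.
    pose proof (mink_lift_gt1 v u Dv (HS u Iu) ltac:(auto)).
    specialize (Hn u Iu). nra. }
  destruct (lift_proj _ F T) as [k [Hk Lk]].
  pose proof (proj_in_disk _ F T) as Dp.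
  set (p := proj (seg (lift v) Q t)) in *.
  assert (Stp : forall u, In u S -> u <> v ->
    mink (lift p) (lift v) < mink (lift p) (lift u)).
  { intros u Iu Nu. rewrite Lk, !mink_lin_l. specialize (St u Iu Nu). nra. }
  (* [Q] lies on the ray from [v] through [M], not beyond [M]. *)
  assert (Key : forall al be M b, 0 <= al -> 0 <= be -> in_disk M -> In b S ->
    b <> v -> V b -> lin al (lift v) be (lift M) = lift p ->
    mink (lift M) (lift v) = mink (lift M) (lift b) ->
    (forall u, In u S -> u <> v -> u <> b ->
       mink (lift M) (lift v) < mink (lift M) (lift u)) -> False).
  { intros al be M b Ha Hb HM Ib Nb Vb L E1 E2.
    set (x := al - k * (1 - t)).
    assert (Y : forall W, x * mink (lift v) W + be * mink (lift M) W
                          = k * t * mink Q W).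
    { intro W. pose proof (f_equal (fun Z => mink Z W) (eq_trans L Lk)) as G.
      cbv beta in G. rewrite !mink_lin_l in G. unfold seg in G.
      rewrite !mink_lin_l in G. unfold x. lra. }
    assert (Kt : 0 < k * t) by nra.
    assert (Fx : k * t * vt Q = x * vt (lift v) + be * vt (lift M)).
    { specialize (Y (Vec 1 0 0)). unfold mink in Y; simpl vt in *; simpl vx in *;
        simpl vy in *. lra. }
    (* Pairing with [lift v] minus [lift b] eliminates [M], which is equidistant from [v] and
       [b]. *)
    assert (Hx : 0 <= x).
    { pose proof (Y (lift v)) as Y1. pose proof (Y (lift b)) as Y2.
      rewrite Nv in Y1. rewrite <- E1 in Y2.
      pose proof (mink_lift_gt1 v b Dv (HS b Ib) ltac:(auto)).
      specialize (Hn b Ib). nra. }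
    pose proof (lift_future M HM) as FM.
    (* For null [Q], pairing with [Q] gives nonnegative terms of sum 0. Otherwise [v] and [M] are
       strictly closer to [v] than to [u], but [Q] is not. *)
    assert (Z : x = 0 /\ be = 0).
    { destruct HQ as [HQ|[u [Iu [Nu Hu]]]].
      - pose proof (Y Q) as Y0. rewrite HQ in Y0.
        pose proof (mink_pos (lift v) Q ltac:(lra) FQ ltac:(lra) TQ).
        pose proof (mink_lift_self M HM).
        pose proof (mink_pos (lift M) Q ltac:(lra) FQ ltac:(lra) TQ).
        split; nra.
      - assert (u <> v) by (intros ->; easy). assert (u <> b) by (intros ->; easy).
        pose proof (Y (lift v)) as Y1. pose proof (Y (lift u)) as Y2.
        rewrite Nv in Y1. specialize (E2 u Iu ltac:(auto) ltac:(auto)).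
        pose proof (mink_lift_gt1 v u Dv (HS u Iu) ltac:(auto)).
        specialize (Hu v Iv). split; nra. }
    destruct Z as [Z1 Z2]. rewrite Z1, Z2 in Fx. nra. }
  destruct (drawing_segment S m V p HS Hm D)
    as [Vp|[a [b [M [al [be [Va [Vb [Ia [Ib [Nab [_ [HM [Ha [Hb [L [E1 E2]]]]]]]]]]]]]]]]].
  - destruct (classic (p = v)) as [E|N].
    + (* then [Q] is a positive multiple of [lift v] *)
      assert (Y : forall W, (1 - k * (1 - t)) * mink (lift v) W = k * t * mink Q W).
      { intro W. rewrite E in Lk. pose proof (f_equal (fun Z => mink Z W) Lk) as G.
        cbv beta in G. rewrite !mink_lin_l in G. unfold seg in G.
        rewrite !mink_lin_l in G. lra. }
      assert (Kt : 0 < k * t) by nra.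
      assert (P : 0 < mink (lift v) Q) by (apply mink_pos; lra).
      pose proof (Y (lift v)) as Y1. rewrite Nv, (mink_comm Q) in Y1.
      set (c := 1 - k * (1 - t)) in *. set (k' := k * t) in *.
      assert (0 < k' * mink (lift v) Q) by (apply Rmult_lt_0_compat; lra).
      assert (Hc : 0 < c) by lra. clearbody c k'.
      destruct HQ as [HQ|[u [Iu [Nu Hu]]]].
      * specialize (Y Q). rewrite HQ in Y. nra.
      * assert (u <> v) by (intros ->; easy).
        specialize (Y (lift u)). specialize (Hu v Iv). rewrite (mink_comm Q (lift v)) in Hu.
        pose proof (mink_lift_gt1 v u Dv (HS u Iu) ltac:(auto)).
        nra.
    + pose proof (Stp p (HV p Vp) N) as X. rewrite mink_lift_self in X by easy.
      pose proof (mink_lift_ge1 p v Dp Dv). lra.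
  - destruct (classic (a = v)) as [->|N].
    + apply (Key al be M b); auto.
    (* A half-edge starting at another site [a] stays at least as close to [a] as to [v], whereas
       [p] is strictly closest to [v]. *)
    + pose proof (Stp a Ia N) as X. rewrite L, !mink_lin_l in X.
      rewrite (mink_lift_self a) in X by auto.
      pose proof (mink_lift_ge1 a v (HS a Ia) Dv).
      assert (mink (lift M) (lift a) <= mink (lift M) (lift v)).
      { destruct (classic (v = b)) as [->|]; [lra|]. apply Rlt_le, E2; auto. }
      nra.
Qed.

Lemma seg_0 A B : seg A B 0 = A.
Proof. apply vec_eq; unfold seg; simpl; ring. Qed.

Lemma seg_1 A B : seg A B 1 = B.
Proof. apply vec_eq; unfold seg; simpl; ring. Qed.

Lemma outer_of_ideal S m (V : pt -> Prop) v Q :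
  (forall s, In s S -> in_disk s) -> valid_midpoints S m ->
  (forall s, V s -> In s S) -> V v -> 0 < vt Q -> mink Q Q = 0 ->
  nearest S Q v -> on_outer_face S m V v.
Proof.
  intros HS Hm HV Vv FQ NQ Hn.
  pose proof (HS v (HV v Vv)) as Dv. pose proof (lift_future v Dv).
  pose proof (mink_lift_self v Dv).
  exists (fun t => proj (seg (lift v) Q t)). split; [|split; [|split]].
  - rewrite seg_0. now apply proj_lift.
  - intros t Ht eps He.
    destruct (seg_proj_eps (lift v) Q t) with eps as [d [Hd K]]; auto.
    + apply seg_future; lra.
    + apply Rlt_le, seg_timelike; lra.
    + exists d; split; auto.
  - intros t Ht. split.
    + apply proj_in_disk; [apply seg_future|apply seg_timelike]; lra.
    + apply cell_segment_free; auto. lra.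
  - apply seg_proj_to_circle; easy.
Qed.

(** The path runs from [v] to the common point, then to [u] inside the free cell of this removed
    site, then along the path of [u]. *)
Lemma outer_of_touch S m (V : pt -> Prop) v u Q :
  (forall s, In s S -> in_disk s) -> valid_midpoints S m ->
  (forall s, V s -> In s S) -> V v -> In u S -> ~ V u ->
  0 < vt Q -> 0 < mink Q Q -> nearest S Q v -> nearest S Q u ->
  on_outer_face S m V u -> on_outer_face S m V v.
Proof.
  intros HS Hm HV Vv Iu Nu FQ TQ Hv Hu Ho.
  pose proof (HS v (HV v Vv)) as Dv. pose proof (lift_future v Dv).
  pose proof (mink_lift_self v Dv). pose proof (HS u Iu) as Du.
  pose proof (lift_future u Du). pose proof (mink_lift_self u Du).
  assert (Free : forall t, 0 <= t <= 1 -> in_disk (proj (seg Q (lift u) t)) /\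
                   ~ drawing S m V (proj (seg Q (lift u) t))).
  { intros t Ht.
    assert (F : 0 < vt (seg Q (lift u) t)) by (apply seg_future; lra).
    assert (T : 0 < mink (seg Q (lift u) t) (seg Q (lift u) t)).
    { destruct (Req_dec t 1) as [->|]; [rewrite seg_1; lra|].
      apply seg_timelike; lra. }
    split; [now apply proj_in_disk|].
    apply removed_cell_free with u; auto; [now apply proj_in_disk|].
    apply nearest_proj; auto. apply seg_nearest; auto. now apply site_nearest. }
  assert (Oq : on_outer_face S m V (proj Q)).
  { rewrite <- (seg_0 Q (lift u)).
    apply (outer_prepend S m V (fun t => proj (seg Q (lift u) t))).
    - intros t Ht eps He. apply seg_proj_eps; auto.
      + apply seg_future; lra.
      + destruct (Req_dec t 1) as [->|]; [rewrite seg_1; lra|].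
        apply Rlt_le, seg_timelike; lra.
    - intros t Ht; apply Free; lra.
    - rewrite seg_1, proj_lift; auto. }
  rewrite <- (proj_lift v Dv), <- (seg_0 (lift v) Q).
  apply (outer_prepend S m V (fun t => proj (seg (lift v) Q t))).
  - intros t Ht eps He. apply seg_proj_eps; auto.
    + apply seg_future; lra.
    + destruct (Req_dec t 1) as [->|]; [rewrite seg_1; lra|].
      apply Rlt_le, seg_timelike; lra.
  - intros t Ht. destruct (Req_dec t 1) as [->|].
    + rewrite seg_1, <- (seg_0 Q (lift u)). apply Free; lra.
    + split; [apply proj_in_disk; [apply seg_future|apply seg_timelike]; lra|].
      apply cell_segment_free; auto; [lra| |lra]. right; exists u; auto.
  - rewrite seg_1; easy.
Qed.

(** Adjacency and midpoints remain those of the full set [S], so removing vertices only shrinks the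
    drawing. *)
Lemma on_outer_face_anti S m (V W : pt -> Prop) v : (forall s, W s -> V s) ->
  on_outer_face S m V v -> on_outer_face S m W v.
Proof.
  intros HW [g [G0 [Gc [Gd Gi]]]]. exists g. repeat (split; [easy|]).
  split; [|easy]. intros t Ht. destruct (Gd t Ht) as [D N]. split; [easy|].
  intro X; apply N. destruct X as [X|[a [b [Va [Vb X]]]]]; [left; auto|].
  right; exists a, b; auto.
Qed.

(** * Rounds of peeling *)

Definition remaining (S : list pt) (m : pt -> pt -> pt) (i : nat) : pt -> Prop :=
  Nat.iter i (peel S m) (fun p => In p S).

Lemma remaining_site S m i v : remaining S m i v -> In v S.
Proof. induction i; simpl; [easy|]. intros [H _]; auto. Qed.

Lemma removed_outer S m i v : In v S -> ~ remaining S m i v ->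
  on_outer_face S m (remaining S m i) v.
Proof.
  intro Iv; induction i; intro H; [easy|].
  apply on_outer_face_anti with (remaining S m i); [now intros s []|].
  destruct (classic (remaining S m i v)) as [R|R]; [|auto].
  apply NNPP; intro N; apply H; split; auto.
Qed.

(** By induction the next site of the chain is gone one round earlier, and its path to infinity,
    which later rounds leave free, exposes [v]. *)
Lemma esc_removed S m i v : (forall s, In s S -> in_disk s) ->
  valid_midpoints S m -> esc S i v -> ~ remaining S m i v.
Proof.
  intros HS Hm He. pose proof (remaining_site S m) as RS.
  induction He as [i v Q Iv FQ NQ Hn|i v u Q Iv Iu FQ TQ Hv Hu He IH];
    intros [R N]; apply N.
  - apply outer_of_ideal with Q; eauto.
  - apply outer_of_touch with u Q; eauto. apply removed_outer; auto.
Qed.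

Lemma k_outerplanar_iter S m k V :
  (forall v, ~ Nat.iter k (peel S m) V v) -> k_outerplanar S m k V.
Proof.
  revert V; induction k; simpl; intros V H; [easy|].
  apply IHk. intro v. rewrite <- Nat.iter_succ_r. apply H.
Qed.

(** * Sites met by a ray *)

Definition clamp (t y : R) : R := Rmax (- y) (Rmin t y).

Lemma clamp_incr t t' y : t <= t' -> clamp t y <= clamp t' y.
Proof.
  intro; unfold clamp. apply Rle_max_compat_l, Rle_min_compat_r; easy.
Qed.

Lemma clamp_le t y : 0 <= y -> clamp t y <= y.
Proof. intro; unfold clamp. apply Rmax_lub; [lra|apply Rmin_r]. Qed.

Lemma clamp_opp t y : 0 <= y -> clamp (- t) y = - clamp t y.
Proof.
  intro; unfold clamp, Rmin.
  destruct (Rle_dec t y), (Rle_dec (- t) y); unfold Rmax;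
    repeat match goal with |- context [Rle_dec ?a ?b] => destruct (Rle_dec a b) end;
    lra.
Qed.

(** Here [a] and [b] are the values of [y dy/dx] at the ends of a step of length [d] on which [f] is
    affine. Growth of [y] beyond unit rate needs a value above [y]; the clamp is then saturated and
    rises with [y]. *)
Lemma clamp_rise d a b y y' : 0 < d -> b <= a <= b + d -> 0 <= y <= y' ->
  y' * y' - y * y = d * (a + b) -> y' - y <= 2 * d + clamp b y' - clamp a y.
Proof.
  intros Hd Hab Hy E.
  assert (0 <= a + b) by nra.
  destruct (Rle_lt_dec y' b) as [Hb|Hb].
  - assert (clamp b y' = y').
    { unfold clamp. rewrite Rmin_right, Rmax_right; lra. }
    pose proof (clamp_le a y). lra.
  - assert (b <= clamp b y').
    { unfold clamp. rewrite Rmin_left by lra. apply Rmax_r. }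
    assert (clamp a y = Rmin a y).
    { unfold clamp. apply Rmax_right. apply Rmin_glb; lra. }
    destruct (Rle_lt_dec a y) as [Ha|Ha].
    + rewrite Rmin_left in * by easy.
      assert (y' - y <= d); [|lra].
      destruct (Req_dec y' 0) as [->|]; [lra|].
      apply Rmult_le_reg_r with (y' + y); [lra|]. nra.
    + rewrite Rmin_right in * by lra.
      assert (y' <= a + d); [|lra]. apply Rnot_lt_le; intro. nra.
Qed.

(** A fall of [y] is a rise of the reversed step, with [-b] and [-a] for [a] and [b], because the
    clamp is odd in its first argument. *)
Lemma clamp_step d a b y y' : 0 < d -> b <= a <= b + d -> 0 <= y -> 0 <= y' ->
  y' * y' - y * y = d * (a + b) ->
  Rabs (y' - y) <= 2 * d + clamp b y' - clamp a y.
Proof.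
  intros Hd Hab Hy Hy' E. destruct (Rle_lt_dec y y').
  - rewrite Rabs_pos_eq by lra. apply clamp_rise; lra.
  - rewrite Rabs_left by lra.
    pose proof (clamp_rise d (- b) (- a) y' y Hd ltac:(lra) ltac:(lra) ltac:(lra)) as H.
    rewrite !clamp_opp in H by lra. lra.
Qed.

(* A site at distance [d] with [f = cosh d], and [x], [y] its other hyperboloid
   coordinates along and across the ray, satisfies [y^2 = f^2 - x^2 - 1]. For the
   sites met by the ray on one side, [f] is a convex function of [x] with slopes
   in [0,1], so that [y dy = (f f' - x) dx] where [f f' - x] decreases at rate at
   most 1 except for upward jumps at the sites. Hence [clamp] of it pays for the
   steep variation [|dy| > dx] of [y]. *)
Definition potential (s f x y : R) : R := 3 * x + clamp (s * f - x) y.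

(** The chord slope [sl] lies between [s] and [s'], so by monotonicity [clamp_step] can be applied
    with [sl]. The increase is at least [d + Rabs (y' - y)], which is at least [r] by the
    separation. *)
Lemma potential_step r s s' f f' x x' y y' : 0 < r ->
  x < x' -> 0 <= s -> s' <= 1 -> 0 < f -> 0 < f' -> 0 <= y -> 0 <= y' ->
  s * (x' - x) <= f' - f <= s' * (x' - x) ->
  f * f - x * x - y * y = 1 -> f' * f' - x' * x' - y' * y' = 1 ->
  r * r <= (x' - x) * (x' - x) + (y' - y) * (y' - y) - (f' - f) * (f' - f) ->
  potential s f x y + r <= potential s' f' x' y'.
Proof.
  intros Hr Hx Hs Hs' Hf Hf' Hy Hy' [S1 S2] N N' Sep. unfold potential.
  set (d := x' - x) in *. assert (Hd : 0 < d) by (unfold d; lra).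
  set (sl := (f' - f) / d).
  assert (E : f' - f = sl * d) by (unfold sl; field; lra).
  assert (L1 : s <= sl) by (apply Rmult_le_reg_r with d; lra).
  assert (L2 : sl <= s') by (apply Rmult_le_reg_r with d; lra).
  assert (C1 : clamp (s * f - x) y <= clamp (sl * f - x) y)
    by (apply clamp_incr; nra).
  assert (C2 : clamp (sl * f' - x') y' <= clamp (s' * f' - x') y')
    by (apply clamp_incr; nra).
  assert (St : Rabs (y' - y) <=
    2 * d + clamp (sl * f' - x') y' - clamp (sl * f - x) y).
  { apply clamp_step; auto.
    - replace f' with (f + sl * d) by lra. replace x' with (x + d) by (unfold d; ring).
      assert (0 <= sl * sl <= 1) by nra. split; nra.
    - replace (y' * y' - y * y) with ((f' - f) * (f' + f) - d * (x' + x))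
        by (unfold d; lra). rewrite E. ring. }
  assert (B : r <= d + Rabs (y' - y)).
  { apply Rnot_lt_le; intro.
    assert (A2 : Rabs (y' - y) * Rabs (y' - y) = (y' - y) * (y' - y)).
    { rewrite <- Rabs_mult. apply Rabs_pos_eq. apply Rle_0_sqr. }
    pose proof (Rabs_pos (y' - y)). pose proof (Rle_0_sqr (f' - f)). unfold Rsqr in *.
    nra. }
  unfold d in *. lra.
Qed.

Lemma list_min {A} (P : A -> Prop) (f : A -> R) l : (exists a, In a l /\ P a) ->
  exists a, In a l /\ P a /\ forall b, In b l -> P b -> f a <= f b.
Proof.
  induction l as [|c l IH]; intros [a [Ia Pa]]; [easy|].
  destruct (classic (exists a, In a l /\ P a)) as [X|X].
  - destruct (IH X) as [b [Ib [Pb Hb]]].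
    destruct (classic (P c /\ f c <= f b)) as [[Pc Hc]|N].
    + exists c. split; [now left|]. split; [easy|]. intros z [<-|Iz] Pz; [lra|].
      specialize (Hb z Iz Pz); lra.
    + exists b. split; [now right|]. split; [easy|]. intros z [<-|Iz] Pz; auto.
      apply Rnot_lt_le; intro; apply N; split; [easy|lra].
  - assert (a = c) as -> by (destruct Ia; auto; exfalso; eauto).
    exists c. split; [now left|]. split; [easy|]. intros z [<-|Iz] Pz; [lra|].
    exfalso; eauto.
Qed.

(** The products with sites are affine in the ray parameter. Among the sites that beat [w] at the
    ideal end, the one that draws level first shares the ray point with [w]. The last inequality
    records progress along the ray. *)
Lemma next_site S V D w s : In w S -> 0 <= s < 1 ->
  nearest S (lin 1 V s D) w -> ~ nearest S (lin 1 V 1 D) w ->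
  exists u t, In u S /\ s <= t < 1 /\
    nearest S (lin 1 V t D) w /\ nearest S (lin 1 V t D) u /\
    mink D (lift u) < mink D (lift w).
Proof.
  intros Iw Hs Hn Hni.
  set (f := fun u => mink V (lift u)). set (x := fun u => - mink D (lift u)).
  assert (E : forall t u, mink (lin 1 V t D) (lift u) = f u - t * x u)
    by (intros; rewrite mink_lin_l; unfold f, x; ring).
  set (P := fun u => f u - x u < f w - x w).
  assert (PX : forall u, In u S -> P u -> x w < x u).
  { intros u Iu Pu. specialize (Hn u Iu). rewrite !E in Hn. unfold P in Pu. nra. }
  set (c := fun u => (f u - f w) / (x u - x w)).
  assert (EC : forall u, In u S -> P u -> f u - f w = c u * (x u - x w)).
  { intros u Iu Pu. pose proof (PX u Iu Pu). unfold c. field. lra. }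
  destruct (list_min P c S) as [u [Iu [Pu Hmin]]].
  { apply NNPP; intro N. apply Hni. intros u Iu. rewrite !E.
    apply Rnot_lt_le; intro. apply N. exists u; split; [easy|]. unfold P; lra. }
  pose proof (PX u Iu Pu) as Xu. pose proof (EC u Iu Pu) as Eu.
  assert (C1 : s <= c u).
  { apply Rmult_le_reg_r with (x u - x w); [lra|]. rewrite <- Eu.
    specialize (Hn u Iu). rewrite !E in Hn. lra. }
  assert (C2 : c u < 1).
  { apply Rmult_lt_reg_r with (x u - x w); [lra|]. rewrite <- Eu.
    unfold P in Pu. lra. }
  assert (Nw : nearest S (lin 1 V (c u) D) w).
  { intros z Iz. rewrite !E. destruct (classic (P z)) as [Pz|Pz].
    - pose proof (EC z Iz Pz). pose proof (PX z Iz Pz).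
      pose proof (Hmin z Iz Pz). nra.
    - unfold P in Pz. specialize (Hn z Iz). rewrite !E in Hn.
      assert (f z - x z >= f w - x w) by lra.
      (* an affine function nonnegative at [s] and [1] is so in between *)
      assert (0 <= (1 - s) * ((f z - c u * x z) - (f w - c u * x w))).
      { replace ((1 - s) * ((f z - c u * x z) - (f w - c u * x w))) with
          ((1 - c u) * ((f z - s * x z) - (f w - s * x w)) +
           (c u - s) * ((f z - x z) - (f w - x w))) by ring.
        apply Rplus_le_le_0_compat; apply Rmult_le_pos; lra. }
      nra. }
  exists u, (c u). split; [easy|]. split; [lra|]. split; [easy|]. split.
  - intros z Iz. specialize (Nw z Iz). rewrite !E in *. lra.
  - unfold x in Xu; lra.
Qed.

(** A Lorentz-orthonormal basis; [frame_mink] expresses that it spans. The spatial coordinates of a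
    vector are minus its products with [E1] and [E2]. *)
Record frame (V E1 E2 : vec) : Prop := {
  frame_future : 0 < vt V;
  frame_00 : mink V V = 1;
  frame_11 : mink E1 E1 = -1;
  frame_22 : mink E2 E2 = -1;
  frame_01 : mink V E1 = 0;
  frame_02 : mink V E2 = 0;
  frame_12 : mink E1 E2 = 0;
  frame_mink : forall U W, mink U W =
    mink U V * mink W V - mink U E1 * mink W E1 - mink U E2 * mink W E2 }.

Lemma frame_rotate V E1 E2 a b : a * a + b * b = 1 -> frame V E1 E2 ->
  frame V (lin a E1 b E2) (lin (- b) E1 a E2).
Proof.
  intros H [F H0 H1 H2 H3 H4 H5 HM]; split; auto;
    rewrite ?mink_lin_l, ?mink_lin_r, ?H1, ?H2, ?H3, ?H4, ?H5,
      ?(mink_comm E2 E1), ?H5; try lra.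
  intros U W. rewrite HM, !mink_lin_r.
  replace (mink U E1 * mink W E1) with ((a * a + b * b) * (mink U E1 * mink W E1))
    by (rewrite H; ring).
  replace (mink U E2 * mink W E2) with ((a * a + b * b) * (mink U E2 * mink W E2))
    by (rewrite H; ring).
  ring.
Qed.

(* The first spatial vector points away from [V] at [U]. *)
Lemma frame_move V E1 E2 U rho : frame V E1 E2 -> mink U U = 1 -> 0 < vt U ->
  0 < rho -> rho * rho = mink U V * mink U V - 1 ->
  frame U (lin (mink U V / rho) U (- / rho) V)
    (lin (- mink U E2 / rho) E1 (mink U E1 / rho) E2).
Proof.
  intros [F H0 H1 H2 H3 H4 H5 HM] HU FU Hr Er.
  pose proof (HM U U) as N. rewrite HU in N.
  set (u0 := mink U V) in *. set (u1 := mink U E1) in *. set (u2 := mink U E2) in *.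
  assert (Er' : rho * rho = u1 * u1 + u2 * u2) by lra.
  assert (Ir : / rho * / rho * (rho * rho) = 1) by (field; lra).
  unfold Rdiv. set (k := / rho) in *.
  split; auto; rewrite ?mink_lin_l, ?mink_lin_r, ?mink_lin_l, ?HU, ?H0, ?H1, ?H2,
    ?(mink_comm E2 E1), ?(mink_comm V U), ?H3, ?H4, ?H5; fold u0; fold u1; fold u2.
  - replace (u0 * k * (u0 * k * 1 + - k * u0) + - k * (u0 * k * u0 + - k * 1))
      with (- (k * k * (u0 * u0 - 1))) by ring. rewrite <- Er. lra.
  - replace (- u2 * k * (- u2 * k * -1 + u1 * k * 0) + u1 * k * (- u2 * k * 0 + u1 * k * -1))
      with (- (k * k * (u1 * u1 + u2 * u2))) by ring. rewrite <- Er'. lra.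
  - ring.
  - ring.
  - ring.
  - intros A B. rewrite HM, !mink_lin_r, (HM A U), (HM B U). fold u0 u1 u2.
    assert (K : k * k * (u1 * u1 + u2 * u2) = 1) by (rewrite <- Er'; easy).
    assert (Q : u0 * u0 = 1 + u1 * u1 + u2 * u2) by lra.
    generalize (mink A V) (mink A E1) (mink A E2) (mink B V) (mink B E1) (mink B E2).
    clear - K Q. intros. nsatz.
Qed.

Lemma ray_mink V E1 E2 t : frame V E1 E2 ->
  mink (lin 1 V t E1) (lin 1 V t E1) = 1 - t * t.
Proof.
  intros [F H0 H1 H2 H3 H4 H5 HM].
  rewrite !mink_lin_l, !mink_lin_r, (mink_comm E1 V), H0, H1, H3. ring.
Qed.

Lemma ray_future V E1 E2 t : frame V E1 E2 -> 0 <= t <= 1 -> 0 < vt (lin 1 V t E1).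
Proof.
  intros [F H0 H1 H2 H3 H4 H5 HM] Ht.
  pose proof (HM (Vec 1 0 0) (Vec 1 0 0)) as N.
  unfold mink in N; simpl in N. unfold lin; simpl.
  assert (vt E1 * vt E1 < vt V * vt V) by nra.
  assert (- vt V < vt E1) by (apply Rnot_le_lt; intro; nra).
  destruct (Rle_lt_dec 0 (vt E1)); nra.
Qed.

Definition hit (S : list pt) (V D : vec) (u : pt) : Prop :=
  exists s, 0 <= s < 1 /\ nearest S (lin 1 V s D) u.

(** Every other site is far, so the first cell entered after that of [v] ends the walk. *)
Lemma walk_sparse S v D D' T A : (forall s, In s S -> in_disk s) -> In v S ->
  frame (lift v) D D' ->
  (forall u, In u S -> u <> v -> A <= mink (lift u) (lift v)) ->
  (forall u, In u S -> hit S (lift v) D u -> A <= mink (lift u) (lift v) ->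
     esc S T u) ->
  esc S (T + 1) v.
Proof.
  intros HS Iv Fr Sep Far. rewrite Nat.add_1_r.
  destruct (classic (nearest S (lin 1 (lift v) 1 D) v)) as [Ni|Ni].
  - apply esc_ideal with (lin 1 (lift v) 1 D); auto.
    + apply (ray_future _ _ _ _ Fr); lra.
    + rewrite (ray_mink _ _ _ _ Fr); ring.
  - destruct (next_site S (lift v) D v 0 Iv) as [u [t [Iu [Ht [Nv [Nu L]]]]]];
      [lra| |easy|].
    + intros u Iu. rewrite !mink_lin_l, mink_lift_self by auto.
      pose proof (mink_lift_ge1 v u ltac:(auto) ltac:(auto)). lra.
    + assert (u <> v) by (intros ->; lra).
      apply esc_touch with u (lin 1 (lift v) t D); auto.
      * apply (ray_future _ _ _ _ Fr); lra.
      * rewrite (ray_mink _ _ _ _ Fr); nra.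
      * apply Far; auto. exists t; split; [lra|easy].
Qed.

Lemma potential_le s f x y A : 0 < f -> 0 <= y -> f < A ->
  f * f - x * x - y * y = 1 -> potential s f x y <= 4 * A.
Proof.
  intros. unfold potential. pose proof (clamp_le (s * f - x) y).
  assert (x < A) by (apply Rnot_le_lt; intro; nra).
  assert (y < A) by (apply Rnot_le_lt; intro; nra). lra.
Qed.

(** One potential is kept for each side of the ray. Both start at 0 and stay at most [4 * A] at near
    sites, and each new near site raises one of them by [r]; so fewer than [K] near cells follow
    that of [v]. *)
Lemma walk_dense S v D D' T A r K : (forall s, In s S -> in_disk s) -> In v S ->
  frame (lift v) D D' -> 0 < r -> 0 < A -> 8 * A < INR K * r ->
  (forall u w, In u S -> In w S -> u <> w ->
     1 + r * r / 2 <= mink (lift u) (lift w)) ->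
  (forall u, In u S -> hit S (lift v) D u -> A <= mink (lift u) (lift v) ->
     esc S T u) ->
  esc S (T + K) v.
Proof.
  intros HS Iv Fr Hr HA HK Sep Far.
  set (f := fun u => mink (lift u) (lift v)).
  set (x := fun u => - mink (lift u) D). set (y := fun u => mink (lift u) D').
  set (Q := fun t => lin 1 (lift v) t D).
  assert (EQ : forall t u, mink (Q t) (lift u) = f u - t * x u).
  { intros. unfold Q, f, x. rewrite mink_lin_l, !(mink_comm (lift u)). ring. }
  assert (EM : forall u w, mink (lift u) (lift w) = f u * f w - x u * x w - y u * y w).
  { intros. rewrite (frame_mink _ _ _ Fr). unfold f, x, y. ring. }
  assert (EN : forall u, In u S -> f u * f u - x u * x u - y u * y u = 1).
  { intros. rewrite <- EM. apply mink_lift_self; auto. }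
  assert (Fp : forall u, In u S -> 0 < f u).
  { intros u Iu. pose proof (mink_lift_ge1 u v ltac:(auto) ltac:(auto)).
    unfold f; lra. }
  (* Being nearest at [t] and [t'] makes these parameters a lower and an upper bound of the slope of
     [f]; [e] reflects either side of the ray to nonnegative [y]. *)
  assert (Step : forall u t w t', In u S -> In w S -> x u < x w -> 0 <= t -> t' < 1 ->
    nearest S (Q t) u -> nearest S (Q t') w ->
    forall e, e = 1 \/ e = -1 -> 0 <= e * y u -> 0 <= e * y w ->
    potential t (f u) (x u) (e * y u) + r <= potential t' (f w) (x w) (e * y w)).
  { intros u t w t' Iu Iw X Ht Ht' Nu Nw e He Yu Yw.
    specialize (Nu w Iw). specialize (Nw u Iu). rewrite !EQ in Nu, Nw.
    pose proof (EN u Iu) as N1. pose proof (EN w Iw) as N2.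
    assert (u <> w) by (intros ->; lra).
    pose proof (Sep u w Iu Iw ltac:(auto)) as Sp. rewrite EM in Sp.
    assert (Ee : e * e = 1) by (destruct He; subst; ring).
    assert (Eu : forall a b, (e * a) * (e * b) = a * b).
    { intros. transitivity (e * e * (a * b)); [ring|rewrite Ee; ring]. }
    apply potential_step; auto; rewrite ?Eu; try lra.
    replace ((e * y w - e * y u) * (e * y w - e * y u))
      with ((e * e) * ((y w - y u) * (y w - y u))) by ring.
    rewrite Ee. nra. }
  (* [ap] and [an] are the potentials of the last sites passed on the sides [y >= 0] and [y <= 0];
     [v] serves both sides at the start. *)
  assert (Main : forall n w s ap an, In w S -> 0 <= s < 1 -> nearest S (Q s) w ->
    ap <= 4 * A -> an <= 4 * A -> 8 * A - ap - an < INR n * r ->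
    (forall u t, In u S -> f u < A -> 0 <= t < 1 -> nearest S (Q t) u -> x w < x u ->
       (0 <= y u -> ap + r <= potential t (f u) (x u) (1 * y u)) /\
       (y u <= 0 -> an + r <= potential t (f u) (x u) (-1 * y u))) ->
    esc S (T + n) w).
  { induction n as [|n IH]; intros w s ap an Iw Hs Nw Hap Han Hm Inv.
    { simpl in Hm; lra. }
    rewrite Nat.add_succ_r, S_INR in *.
    destruct (classic (nearest S (Q 1) w)) as [Ni|Ni].
    - apply esc_ideal with (Q 1); auto.
      + apply (ray_future _ _ _ _ Fr); lra.
      + unfold Q; rewrite (ray_mink _ _ _ _ Fr); ring.
    - destruct (next_site S (lift v) D w s Iw Hs Nw Ni)
        as [u [t [Iu [Ht [Nw' [Nu L]]]]]].
      assert (X : x w < x u) by (unfold x; rewrite !(mink_comm _ D); lra).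
      apply esc_touch with u (Q t); auto.
      + apply (ray_future _ _ _ _ Fr); lra.
      + unfold Q; rewrite (ray_mink _ _ _ _ Fr); nra.
      + destruct (Rle_lt_dec A (f u)) as [Fu|Fu].
        { apply esc_mono with T; [lia|]. apply Far; auto.
          exists t; split; [lra|easy]. }
        destruct (Inv u t Iu Fu ltac:(lra) Nu X) as [Ip In_].
        pose proof (EN u Iu) as Nm. pose proof (Fp u Iu).
        destruct (Rle_lt_dec 0 (y u)) as [Yu|Yu].
        * apply IH with t (potential t (f u) (x u) (1 * y u)) an; auto; [lra| | |].
          -- apply potential_le; auto; lra.
          -- specialize (Ip Yu); lra.
          -- intros z tz Iz Fz Htz Nz Xz. split; intro Yz.
             ++ apply Step; auto; lra.
             ++ apply Inv; auto; lra.
        * apply IH with t ap (potential t (f u) (x u) (-1 * y u)); auto; [lra| | |].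
          -- apply potential_le; auto; lra.
          -- specialize (In_ ltac:(lra)); lra.
          -- intros z tz Iz Fz Htz Nz Xz. split; intro Yz.
             ++ apply Inv; auto; lra.
             ++ apply Step; auto; lra. }
  assert (Nv : nearest S (Q 0) v).
  { intros u Iu. rewrite !EQ. pose proof (mink_lift_self v ltac:(auto)).
    pose proof (mink_lift_ge1 u v ltac:(auto) ltac:(auto)). unfold f; lra. }
  assert (Xv : x v = 0) by (unfold x; rewrite (frame_01 _ _ _ Fr); ring).
  assert (Yv : y v = 0) by (unfold y; apply (frame_02 _ _ _ Fr)).
  assert (Pv : forall e, potential 0 (f v) (x v) (e * y v) = 0).
  { intro e. rewrite Xv, Yv. unfold potential, clamp.
    replace (0 * f v - 0) with 0 by ring. replace (e * 0) with 0 by ring.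
    rewrite Rmin_left, Rmax_right; lra. }
  apply Main with 0 0 0; auto; try lra.
  intros u t Iu Fu Ht Nu X. split; intro Yu.
  - rewrite <- (Pv 1). apply Step; auto; rewrite ?Yv; lra.
  - rewrite <- (Pv (-1)). apply Step; auto; rewrite ?Yv; lra.
Qed.

(** * Directions of distant half-planes *)

Lemma sqr_le_abs a b : 0 <= b -> a * a <= b * b -> Rabs a <= b.
Proof. intros; apply Rabs_le; split; apply Rnot_lt_le; intro; nra. Qed.

Lemma sqr_lt_abs a b : 0 <= b -> a * a < b * b -> Rabs a < b.
Proof. intros; apply Rabs_def1; apply Rnot_le_lt; intro; nra. Qed.

(* In the Klein model centred at [v], [u] is far from [v] and not farther than
   [v] from some point of the ray in direction [e]; the half-plane at [u]
   perpendicular to [vu] is then close to the ideal point [e]. *)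
Lemma half_plane_near_direction M u0 u1 u2 e1 e2 w0 w1 w2 : 1 <= M ->
  256 * (M * M) <= u0 -> u0 * u0 - u1 * u1 - u2 * u2 = 1 ->
  e1 * e1 + e2 * e2 = 1 -> u0 - 1 <= e1 * u1 + e2 * u2 ->
  0 < w0 -> w0 * w0 - w1 * w1 - w2 * w2 = 1 ->
  (u0 * u0 - 1) * w0 <= u0 * (u1 * w1 + u2 * w2) ->
  Rabs (w1 / w0 - e1) < 1 / (4 * M) /\ Rabs (w2 / w0 - e2) < 1 / (4 * M).
Proof.
  intros HM Hu Nu Ne Hx Hw Nw Hh.
  assert (HMM : 1 <= M * M) by nra.
  assert (HR : 0 < u0 * u0 - 1) by nra.
  pose proof (sqrt_lt_R0 _ HR) as Rp. pose proof (sqrt_sqrt (u0 * u0 - 1) ltac:(lra)) as RR.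
  set (rho := sqrt (u0 * u0 - 1)) in *.
  assert (R1 : rho <= u0) by (apply Rnot_lt_le; intro; nra).
  set (a1 := u1 / rho). set (a2 := u2 / rho).
  assert (U1 : u1 = a1 * rho) by (unfold a1; field; lra).
  assert (U2 : u2 = a2 * rho) by (unfold a2; field; lra).
  set (k1 := w1 / w0). set (k2 := w2 / w0).
  assert (W1 : w1 = k1 * w0) by (unfold k1; field; lra).
  assert (W2 : w2 = k2 * w0) by (unfold k2; field; lra).
  clearbody a1 a2 k1 k2 rho. subst u1 u2 w1 w2.
  assert (Na : a1 * a1 + a2 * a2 = 1) by (apply Rmult_eq_reg_r with (rho * rho); nra).
  assert (Nk : k1 * k1 + k2 * k2 < 1).
  { apply Rmult_lt_reg_r with (w0 * w0); [nra|]. nra. }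
  assert (Xa : 1 - 2 / (u0 + 1) <= e1 * a1 + e2 * a2).
  { apply Rmult_le_reg_r with rho; [easy|].
    apply Rle_trans with (u0 - 1); [|lra].
    replace (1 - 2 / (u0 + 1)) with ((u0 - 1) / (u0 + 1)) by (field; lra).
    apply Rmult_le_reg_r with (u0 + 1); [lra|].
    replace ((u0 - 1) / (u0 + 1) * rho * (u0 + 1)) with ((u0 - 1) * rho) by (field; lra).
    nra. }
  assert (Xk : 1 - 1 / (u0 * u0) <= a1 * k1 + a2 * k2).
  { assert (G : rho <= u0 * (a1 * k1 + a2 * k2)).
    { apply Rmult_le_reg_r with (rho * w0); [nra|]. nra. }
    apply Rmult_le_reg_r with (u0 * u0); [nra|].
    replace ((1 - 1 / (u0 * u0)) * (u0 * u0)) with (rho * rho) by (rewrite RR; field; lra).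
    nra. }
  (* Half the tolerance: the unit vector [a] towards [u] is within [q] of [e], and the Klein point
     [k] within [q] of [a]. The factor 256 is what [4 / (u0 + 1) <= q * q] asks for. *)
  set (q := 1 / (8 * M)).
  assert (Hq : 0 < q) by (apply Rdiv_lt_0_compat; lra).
  assert (Eq : q * q * (64 * (M * M)) = 1) by (unfold q; field; lra).
  assert (B1 : 4 / (u0 + 1) <= q * q).
  { apply Rmult_le_reg_r with (u0 + 1); [lra|].
    replace (4 / (u0 + 1) * (u0 + 1)) with 4 by (field; lra). nra. }
  assert (B2 : 2 * (1 / (u0 * u0)) <= q * q).
  { apply Rmult_le_reg_r with (u0 * u0); [nra|].
    replace (2 * (1 / (u0 * u0)) * (u0 * u0)) with 2 by (field; lra).
    assert (256 * (M * M) <= u0 * u0) by nra. nra. }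
  replace (4 / (u0 + 1)) with (2 * (2 / (u0 + 1))) in B1 by (field; lra).
  assert (D1 : (a1 - e1) * (a1 - e1) + (a2 - e2) * (a2 - e2) <= q * q) by lra.
  assert (D2 : (k1 - a1) * (k1 - a1) + (k2 - a2) * (k2 - a2) < q * q) by lra.
  replace (1 / (4 * M)) with (q + q) by (unfold q; field; lra).
  assert (Sq : forall z, 0 <= z * z) by (intro; apply Rle_0_sqr).
  pose proof (Sq (a1 - e1)). pose proof (Sq (a2 - e2)).
  pose proof (Sq (k1 - a1)). pose proof (Sq (k2 - a2)).
  split.
  - replace (k1 - e1) with ((k1 - a1) + (a1 - e1)) by ring.
    eapply Rle_lt_trans; [apply Rabs_triang|].
    apply Rplus_lt_le_compat; [apply sqr_lt_abs|apply sqr_le_abs]; lra.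
  - replace (k2 - e2) with ((k2 - a2) + (a2 - e2)) by ring.
    eapply Rle_lt_trans; [apply Rabs_triang|].
    apply Rplus_lt_le_compat; [apply sqr_lt_abs|apply sqr_le_abs]; lra.
Qed.

(** * Branching *)

(* [A] is a bound on [cosh] of the distance. *)
Definition walkable (S : list pt) (A : R) (K : nat) : Prop :=
  forall v D D' T, In v S -> frame (lift v) D D' ->
    (forall u, In u S -> hit S (lift v) D u -> A <= mink (lift u) (lift v) ->
       esc S T u) ->
    esc S (T + K) v.

(** In the Klein model centred at [v], a strip of half-width [h] about height [c] on the side of
    [E1]: one coordinate suffices to separate such strips. *)
Definition in_sector (v : pt) (E1 E2 : vec) (c h : R) (w : pt) : Prop :=
  mink (lift w) E1 < 0 /\
  Rabs (- mink (lift w) E2 / mink (lift w) (lift v) - c) < h.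

(** The contrapositive of [walkable], for the ray whose direction has height [e2], gives a far site
    [u] not joined to infinity within [T] cells. The [N] sites found at [u], in the frame pointing
    away from [v], lie in the half-plane at [u], hence in the strip. *)
Lemma sector_list S M K N T v E1 E2 i :
  (forall s, In s S -> in_disk s) -> (i < M)%nat ->
  walkable S (256 * (INR M * INR M)) K ->
  (forall u F1 F2, In u S -> frame (lift u) F1 F2 -> ~ esc S T u ->
     exists l, NoDup l /\ incl l S /\ length l = N /\
       forall w, In w l -> w = u \/ mink (lift w) F1 < 0) ->
  In v S -> frame (lift v) E1 E2 -> ~ esc S (T + K) v ->
  exists l, NoDup l /\ incl l S /\ length l = N /\
    forall w, In w l ->
      in_sector v E1 E2 (INR i / (2 * INR M)) (1 / (4 * INR M)) w.
Proof.
  intros HS Hi Walk IH Iv Fr Nesc.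
  assert (HM : 1 <= INR M) by (apply (le_INR 1); lia).
  assert (HiM : INR i + 1 <= INR M) by (rewrite <- S_INR; apply le_INR; lia).
  pose proof (pos_INR i).
  set (e2 := INR i / (2 * INR M)).
  assert (E20 : 0 <= e2) by (apply Rle_mult_inv_pos; lra).
  assert (E21 : e2 <= 1 / 2).
  { unfold e2. apply Rmult_le_reg_r with (2 * INR M); [lra|].
    replace (INR i / (2 * INR M) * (2 * INR M)) with (INR i) by (field; lra). lra. }
  set (e1 := sqrt (1 - e2 * e2)).
  assert (Ne : e1 * e1 + e2 * e2 = 1).
  { unfold e1. rewrite sqrt_sqrt; [ring|nra]. }
  assert (E10 : 1 / 2 < e1).
  { pose proof (sqrt_pos (1 - e2 * e2)). fold e1 in H0. nra. }
  assert (HM2 : 1 <= INR M * INR M) by nra.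
  pose proof (frame_rotate _ _ _ e1 e2 Ne Fr) as Fr'.
  assert (Hu : exists u, In u S /\ hit S (lift v) (lin e1 E1 e2 E2) u /\
    256 * (INR M * INR M) <= mink (lift u) (lift v) /\ ~ esc S T u).
  { apply NNPP; intro N0. apply Nesc. apply (Walk v _ _ T Iv Fr').
    intros u Iu Hit Far. apply NNPP; intro. apply N0; exists u; auto. }
  destruct Hu as [u [Iu [[s [Hs Ns]] [Far Nu]]]].
  pose proof (HS u Iu) as Du. pose proof (HS v Iv) as Dv.
  assert (Coord : forall w, in_disk w ->
    mink (lift w) (lift v) * mink (lift w) (lift v) -
    (- mink (lift w) E1) * (- mink (lift w) E1) -
    (- mink (lift w) E2) * (- mink (lift w) E2) = 1).
  { intros w Dw. transitivity (mink (lift w) (lift w)); [|now apply mink_lift_self].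
    rewrite (frame_mink _ _ _ Fr (lift w) (lift w)). ring. }
  set (u0 := mink (lift u) (lift v)) in *.
  assert (X : u0 - 1 <= e1 * - mink (lift u) E1 + e2 * - mink (lift u) E2).
  { specialize (Ns v Iv). rewrite !mink_lin_l, (mink_lift_self v Dv) in Ns.
    rewrite !(mink_comm _ (lift u)), !(mink_comm _ (lift v)) in Ns.
    rewrite (mink_comm (lift v) (lift u)) in Ns.
    fold u0 in Ns. rewrite (frame_01 _ _ _ Fr), (frame_02 _ _ _ Fr) in Ns. nra. }
  assert (HR : 0 < u0 * u0 - 1) by nra.
  pose proof (sqrt_lt_R0 _ HR) as Rp.
  pose proof (sqrt_sqrt (u0 * u0 - 1) ltac:(lra)) as RR.
  set (rho := sqrt (u0 * u0 - 1)) in *.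
  destruct (IH u _ _ Iu (frame_move _ _ _ (lift u) rho Fr (mink_lift_self u Du)
    ltac:(pose proof (lift_future u Du); lra) Rp RR) Nu) as [l [Nd [Inc [Len Hl]]]].
  exists l. repeat (split; [easy|]). intros w Iw.
  pose proof (HS w (Inc w Iw)) as Dw.
  pose proof (mink_lift_ge1 w v Dw Dv) as W1.
  assert (W0 : 0 < mink (lift w) (lift v)) by lra.
  (* This is the half-plane at [u] in coordinates at [v]; [u] itself is on its boundary. *)
  assert (Hp : (u0 * u0 - 1) * mink (lift w) (lift v) <=
    u0 * (- mink (lift u) E1 * - mink (lift w) E1 +
          - mink (lift u) E2 * - mink (lift w) E2)).
  { destruct (Hl w Iw) as [->|Neg].
    - pose proof (Coord u Du) as C. fold u0 in C |- *. apply Req_le.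
      replace (- mink (lift u) E1 * - mink (lift u) E1 +
          - mink (lift u) E2 * - mink (lift u) E2) with (u0 * u0 - 1) by lra. ring.
    - rewrite mink_lin_r in Neg. fold u0 in Neg.
      apply (Rmult_lt_compat_l rho) in Neg; [|easy].
      replace (rho * (u0 / rho * mink (lift w) (lift u) +
                      - / rho * mink (lift w) (lift v)))
        with (u0 * mink (lift w) (lift u) - mink (lift w) (lift v)) in Neg
        by (field; lra).
      rewrite (frame_mink _ _ _ Fr (lift w) (lift u)) in Neg. fold u0 in Neg. lra. }
  destruct (half_plane_near_direction (INR M) u0 _ _ e1 e2 _ _ _ HM Far
    (Coord u Du) Ne X W0 (Coord w Dw) Hp) as [B1 B2].
  split; [|exact B2].
  (* The first Klein coordinate differs from [e1 > 1/2] by less than 1/4, hence is positive. *)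
  assert (1 / (4 * INR M) <= 1 / 4).
  { apply Rmult_le_reg_r with (4 * INR M); [lra|].
    replace (1 / (4 * INR M) * (4 * INR M)) with 1 by (field; lra). lra. }
  apply Rabs_def2 in B1.
  assert (P : 0 < - mink (lift w) E1 / mink (lift w) (lift v)) by lra.
  apply (Rmult_lt_compat_r (mink (lift w) (lift v))) in P; [|lra].
  replace (- mink (lift w) E1 / mink (lift w) (lift v) * mink (lift w) (lift v))
    with (- mink (lift w) E1) in P by (field; lra). lra.
Qed.

(** If [(j + 1) * K] cells do not suffice at [v], each of [M] disjoint strips contains [M ^ j]
    sites, supplied by induction at a far site for which [j * K] cells do not suffice. *)
Lemma esc_tree S M K : (forall s, In s S -> in_disk s) -> (1 <= M)%nat ->
  walkable S (256 * (INR M * INR M)) K ->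
  forall j v E1 E2, In v S -> frame (lift v) E1 E2 -> ~ esc S (j * K) v ->
  exists l, NoDup l /\ incl l S /\ length l = (M ^ j)%nat /\
    forall w, In w l -> w = v \/ mink (lift w) E1 < 0.
Proof.
  intros HS HM Walk. induction j as [|j IH]; intros v E1 E2 Iv Fr Nesc.
  { exists (v :: nil). repeat split.
    - constructor; [easy|constructor].
    - intros w [<-|[]]; easy.
    - intros w [<-|[]]; now left. }
  assert (HMr : 1 <= INR M) by (apply (le_INR 1); lia).
  assert (Mrg : forall n, (n <= M)%nat ->
    exists l, NoDup l /\ incl l S /\ length l = (n * M ^ j)%nat /\
      forall w, In w l -> exists i, (i < n)%nat /\
        in_sector v E1 E2 (INR i / (2 * INR M)) (1 / (4 * INR M)) w).
  { induction n as [|n IHn]; intro Hn.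
    { exists nil. repeat split; [constructor|easy|easy]. }
    destruct (IHn ltac:(lia)) as [l1 [N1 [I1 [L1 P1]]]].
    destruct (sector_list S M K (M ^ j) (j * K) v E1 E2 n HS Hn Walk IH Iv Fr)
      as [l2 [N2 [I2 [L2 P2]]]].
    { rewrite Nat.add_comm. exact Nesc. }
    exists (l1 ++ l2). split; [|split; [|split]].
    - apply NoDup_app; auto. intros w W1 W2.
      destruct (P1 w W1) as [i [Hi [_ B1]]]. destruct (P2 w W2) as [_ B2].
      apply Rabs_def2 in B1. apply Rabs_def2 in B2.
      assert (Hin : INR i + 1 <= INR n) by (rewrite <- S_INR; apply le_INR; lia).
      (* Consecutive centres are exactly two half-widths apart, and the strips are open. *)
      assert (INR n / (2 * INR M) - INR i / (2 * INR M) >= 2 * (1 / (4 * INR M)));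
        [|lra].
      apply Rle_ge, Rmult_le_reg_r with (2 * INR M); [lra|]. field_simplify; lra.
    - apply incl_app; easy.
    - rewrite length_app, L1, L2; lia.
    - intros w Iw. apply in_app_or in Iw as [Iw|Iw].
      + destruct (P1 w Iw) as [i [Hi B]]. exists i; split; [lia|easy].
      + exists n; split; [lia|auto]. }
  destruct (Mrg M (le_n M)) as [l [N [I [L P]]]].
  exists l. repeat (split; [easy|]). intros w Iw.
  destruct (P w Iw) as [i [_ [B _]]]. now right.
Qed.

(** The standard frame is moved from the origin to [v]; moving needs a direction, so the origin is a
    separate case. *)
Lemma frame_exists v : in_disk v -> exists E1 E2, frame (lift v) E1 E2.
Proof.
  intro Dv. pose proof (mink_lift_self v Dv) as N. pose proof (lift_future v Dv) as F.
  assert (Fr : frame (Vec 1 0 0) (Vec 0 1 0) (Vec 0 0 1)).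
  { split; unfold mink; simpl; try lra. intros; ring. }
  assert (E : mink (lift v) (Vec 1 0 0) = vt (lift v)) by (unfold mink; simpl; ring).
  destruct (Req_dec (vt (lift v)) 1) as [H|H].
  - assert (lift v = Vec 1 0 0) as ->.
    { unfold mink in N. rewrite H in N.
      destruct (Rplus_sqr_eq_0 (vx (lift v)) (vy (lift v))); [unfold Rsqr; lra|].
      apply vec_eq; easy. }
    eauto.
  - assert (HR : 0 < vt (lift v) * vt (lift v) - 1) by nra.
    eexists; eexists. eapply (frame_move _ _ _ (lift v)
      (sqrt (vt (lift v) * vt (lift v) - 1)) Fr N); [lra| |].
    + apply sqrt_lt_R0; easy.
    + rewrite sqrt_sqrt, E; lra.
Qed.

Lemma esc_of_card S M K j : (forall s, In s S -> in_disk s) -> (1 <= M)%nat ->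
  walkable S (256 * (INR M * INR M)) K -> (length S < M ^ j)%nat ->
  forall v, In v S -> esc S (j * K) v.
Proof.
  intros HS HM Walk Hj v Iv. apply NNPP; intro N.
  destruct (frame_exists v (HS v Iv)) as [E1 [E2 Fr]].
  destruct (esc_tree S M K HS HM Walk j v E1 E2 Iv Fr N) as [l [Nd [Inc [L _]]]].
  apply (NoDup_incl_length Nd) in Inc. lia.
Qed.

(** * Consequences of the separation, and the final count *)

Lemma exp_le_of_hdist s t r : in_disk s -> in_disk t -> hdist s t >= 2 * r ->
  let X := mink (lift s) (lift t) in exp r * exp r <= X + sqrt (X * X - 1).
Proof.
  intros Hs Ht H. cbv zeta. rewrite hdist_mink in H by easy.
  rewrite <- exp_plus, <- exp_acosh by (apply mink_lift_ge1; easy).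
  destruct H as [H|H].
  - apply Rlt_le, exp_increasing; lra.
  - rewrite H. apply Req_le; f_equal; ring.
Qed.

(** Follows from [exp r > 1 + r]. It supplies the separation in [potential_step], since
    [2 * (mink - 1)] is minus the Minkowski square of the difference of the lifts. *)
Lemma mink_ge_quadratic s t r : 0 < r -> in_disk s -> in_disk t ->
  hdist s t >= 2 * r -> 1 + r * r / 2 <= mink (lift s) (lift t).
Proof.
  intros Hr Hs Ht H. pose proof (exp_le_of_hdist s t r Hs Ht H) as E. cbv zeta in E.
  pose proof (mink_lift_ge1 s t Hs Ht). set (X := mink (lift s) (lift t)) in *.
  pose proof (exp_ineq1 r ltac:(lra)).
  pose proof (sqrt_sqrt (X * X - 1) ltac:(nra)) as Q. pose proof (sqrt_pos (X * X - 1)).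
  set (q := sqrt (X * X - 1)) in *.
  assert (Z : (1 + r) * (1 + r) <= X + q) by nra.
  apply Rnot_lt_le; intro L.
  assert (q < r + r * r / 2); [|lra].
  apply Rnot_le_lt; intro. nra.
Qed.

Lemma mink_ge_exp s t r : 0 < r -> in_disk s -> in_disk t ->
  hdist s t >= 2 * r -> exp r * exp r <= 2 * mink (lift s) (lift t).
Proof.
  intros Hr Hs Ht H. pose proof (exp_le_of_hdist s t r Hs Ht H) as E. cbv zeta in E.
  pose proof (mink_lift_ge1 s t Hs Ht). set (X := mink (lift s) (lift t)) in *.
  pose proof (sqrt_sqrt (X * X - 1) ltac:(nra)) as Q. pose proof (sqrt_pos (X * X - 1)).
  set (q := sqrt (X * X - 1)) in *.
  assert (q <= X) by (apply Rnot_lt_le; intro; nra). lra.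
Qed.

Lemma nat_floor x : 0 <= x -> exists n, INR n <= x < INR n + 1.
Proof.
  intro Hx. destruct (archimed x) as [A B].
  assert (0 < up x)%Z by (apply lt_IZR; lra).
  exists (Z.to_nat (up x - 1)).
  rewrite INR_IZR_INZ, Z2Nat.id by lia. rewrite minus_IZR. lra.
Qed.

Lemma log_floor M n : (2 <= M)%nat -> (1 <= n)%nat ->
  exists j, (n < M ^ (j + 1))%nat /\ INR j * ln (INR M) <= ln (INR n).
Proof.
  intros HM Hn.
  assert (B : forall p, (n < M ^ p)%nat -> exists k, (M ^ k <= n < M ^ (k + 1))%nat).
  { induction p as [|p IH]; intro Hp; [simpl in Hp; lia|].
    destruct (Nat.lt_ge_cases n (M ^ p)); [auto|].
    exists p. rewrite Nat.add_1_r. auto. }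
  destruct (B n) as [j [B1 B2]]; [apply Nat.pow_gt_lin_r; lia|].
  exists j; split; [easy|].
  assert (0 < INR M) by (apply lt_0_INR; lia).
  apply le_INR in B1. rewrite pow_INR in B1.
  rewrite <- ln_pow by easy.
  assert (P : 0 < INR M ^ j) by (apply pow_lt; easy).
  destruct B1 as [B1|B1].
  - apply Rlt_le, ln_increasing; easy.
  - rewrite B1. apply Rle_refl.
Qed.

Theorem theorem4 :
  exists C : R, C > 0 /\
  forall (r : R) (S : list pt) (m : pt -> pt -> pt),
    r > 0 ->
    (1 <= length S)%nat ->
    NoDup S ->
    (forall s, In s S -> in_disk s) ->
    (forall s t, In s S -> In t S -> s <> t -> hdist s t >= 2 * r) ->
    valid_midpoints S m ->
    exists k : nat,
      INR k <= 1 + C * ln (INR (length S)) / r /\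
      k_outerplanar S m k (fun p => In p S).
Proof.
  (* The case of small [r] needs 4 * 8240 = 32960. *)
  exists 40000. split; [lra|]. intros r S m Hr HS1 Nd HS Sep Hm.
  enough (exists k, INR k <= 1 + 40000 * ln (INR (length S)) / r /\
    forall v, In v S -> esc S k v) as [k [Hk He]].
  { exists k. split; [easy|]. apply k_outerplanar_iter. intros v Hv.
    apply (esc_removed S m k v HS Hm); [|exact Hv].
    apply He. now apply remaining_site in Hv. }
  set (n := length S) in *.
  assert (Hn : 1 <= INR n) by (apply (le_INR 1); easy).
  destruct (Rle_lt_dec 24 (exp (r / 2))) as [Large|Small].
  (* As 23^2 > 512, [256 * M^2] is at most [exp (2 * r) / 2], so every other site is far. The
     threshold 24 ensures [M >= exp (r / 2)], so that [ln M >= r / 2]. *)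
  - destruct (nat_floor (exp r / 23)) as [M [M1 M2]].
    { pose proof (exp_pos r); lra. }
    assert (Er : exp r = exp (r / 2) * exp (r / 2))
      by (rewrite <- exp_plus; f_equal; lra).
    assert (HM : exp (r / 2) <= INR M) by nra.
    assert (HM2 : (2 <= M)%nat) by (apply INR_le; simpl; lra).
    destruct (log_floor M n HM2 HS1) as [j [J1 J2]].
    exists (j + 1)%nat. split.
    + assert (L : r / 2 <= ln (INR M)).
      { rewrite <- (ln_exp (r / 2)). destruct HM as [HM|HM].
        - apply Rlt_le, ln_increasing; [apply exp_pos|easy].
        - rewrite HM; apply Rle_refl. }
      pose proof (pos_INR j).
      assert (J3 : INR j * r <= 40000 * ln (INR n)) by nra.
      rewrite plus_INR; simpl (INR 1).
      apply Rmult_le_reg_r with r; [easy|].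
  replace ((1 + 40000 * ln (INR n) / r) * r) with (r + 40000 * ln (INR n))
        by (field; lra). lra.
    + rewrite <- (Nat.mul_1_r (j + 1)).
      apply esc_of_card with M; auto; [lia|].
      intros v D D' T Iv Fr Far.
      apply walk_sparse with D D' (256 * (INR M * INR M)); auto.
      intros u Iu Nu.
      pose proof (mink_ge_exp u v r Hr (HS u Iu) (HS v Iv) (Sep u v Iu Iv Nu)).
      pose proof (pos_INR M). nra.
  (* For one site the bound is exactly 1; its cell is the whole plane. *)
  - destruct (Nat.eq_dec n 1) as [N1|N1].
    { exists 1%nat. split; [rewrite N1; simpl; rewrite ln_1; lra|].
      intros v Iv. destruct (frame_exists v (HS v Iv)) as [E1 [E2 Fr]].
      apply esc_ideal with (lin 1 (lift v) 1 E1); auto.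
      - apply (ray_future _ _ _ _ Fr); lra.
      - rewrite (ray_mink _ _ _ _ Fr); ring.
      - destruct S as [|a [|b S]]; try easy.
        destruct Iv as [<-|[]]. intros u [<-|[]]. apply Rle_refl. }
    assert (r < 48) by (pose proof (exp_ineq1 (r / 2) ltac:(lra)); lra).
    assert (Hn2 : 2 <= INR n) by (apply (le_INR 2); lia).
    (* With [M = 2] sites are far from 256 * 4 = 1024 on, and [walk_dense] needs more than 8 * 1024
       = 8192 for the cell count times [r]; hence [K + 1] cells. *)
    destruct (nat_floor (8192 / r)) as [K [K1 K2]].
    { apply Rle_mult_inv_pos; lra. }
    destruct (log_floor 2 n ltac:(lia) HS1) as [j [J1 J2]].
    exists ((j + 1) * (K + 1))%nat. split.
    + pose proof ln_lt_2 as L2. replace (INR 2) with 2 in J2 by (simpl; ring).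
      pose proof (pos_INR j).
      assert (Ln : ln 2 <= ln (INR n)) by (destruct Hn2 as [Hn2|<-];
        [apply Rlt_le, ln_increasing; lra|apply Rle_refl]).
      (* Since [ln 2 > 1/2] and [n >= 2], both [j] and the extra level are at most [2 * ln n]. *)
      assert (Hj : INR j + 1 <= 4 * ln (INR n)) by nra.
      assert (HK : INR K + 1 <= 8240 / r).
      { apply Rmult_le_reg_r with r; [easy|].
        apply (Rmult_le_compat_r r) in K1; [|lra].
        replace (8192 / r * r) with 8192 in K1 by (field; lra).
        replace (8240 / r * r) with 8240 by (field; lra). lra. }
      rewrite mult_INR, !plus_INR; simpl (INR 1). pose proof (pos_INR K).
      assert ((INR j + 1) * (INR K + 1) <= 4 * ln (INR n) * (8240 / r))
        by (apply Rmult_le_compat; lra).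
      replace (4 * ln (INR n) * (8240 / r)) with (32960 * (ln (INR n) / r)) in *
        by (field; lra).
      replace (40000 * ln (INR n) / r) with (40000 * (ln (INR n) / r))
        by (field; lra).
      assert (0 <= ln (INR n) / r) by (apply Rle_mult_inv_pos; lra). lra.
    + apply esc_of_card with 2%nat; auto.
      intros v D D' T Iv Fr Far.
      apply walk_dense with D D' 1024 r; auto; try lra.
      * rewrite plus_INR; simpl (INR 1).
        apply (Rmult_lt_compat_r r) in K2; [|easy].
        replace (8192 / r * r) with 8192 in K2 by (field; lra). lra.
      * intros u w Iu Iw Nuw. apply mink_ge_quadratic; auto.
      * intros u Iu Hu Fu. apply Far; auto. simpl (INR 2). lra.
Qed.
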